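(* Let $\omega=(\omega_x)_{x\in\mathbb Z}$ be i.i.d. random variables with values in $(0,1)$ and joint law $\mathbb P$, and set $\rho_x=(1-\omega_x)/\omega_x$. Assume: (i) there exists $\varepsilon_0\in(0,1/2)$ with $\mathbb P[\omega_0\in[\varepsilon_0,1-\varepsilon_0]]=1$; (ii) $\mathbb E(\log\rho_0)<0$; (iii) there exists $0<\kappa<1$ such that $\mathbb E(\rho_0^\kappa)=1$. Let $d\ge 2$ and let $x_1,\dots,x_d\in\mathbb Z$ all have the same parity. Then $\mathbb P^{(x_1,\dots,x_d)}$-almost surely there exist infinitely many $n\in\mathbb N$ such that $S^{(1)}_n=S^{(2)}_n=\dots=S^{(d)}_n$.
   Context: Given an environment $\omega$, under the quenched law $P_\omega^{(x_1,\dots,x_d)}$ the processes $S^{(j)}=(S^{(j)}_n)_{n\in\mathbb N}$, $1\le j\le d$, are independent Markov chains on $\mathbb Z$ with $S^{(j)}_0=x_j$ and transition probabilities $P(S^{(j)}_{n+1}=y+1\mid S^{(j)}_n=y)=\omega_y$, $P(S^{(j)}_{n+1}=y-1\mid S^{(j)}_n=y)=1-\omega_y$ (random walks in the same random environment $\omega$). The annealed law is $\mathbb P^{(x_1,\dots,x_d)}(\cdot)=\int P_\omega^{(x_1,\dots,x_d)}(\cdot)\,\mathbb P(d\omega)$. Here $\mathbb N=\{0,1,2,\dots\}$. *)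

(* Defs.v *)
From HB Require Import structures.
From mathcomp Require Import all_boot all_order all_algebra.
From mathcomp Require Import all_classical all_reals all_analysis.
Set Implicit Arguments. Unset Strict Implicit. Unset Printing Implicit Defensive.
Import Order.TTheory GRing.Theory Num.Theory.
Local Open Scope classical_set_scope.
Local Open Scope ring_scope.

Definition iid_family {d0 : measure_display} {T : measurableType d0} {R : realType}
  (P : probability T R) (w : int -> T -> R) : Prop :=
  (forall x, measurable_fun setT (w x)) /\
  (forall (s : seq int) (B : int -> set R), uniq s -> (forall x, measurable (B x)) ->
     P (\bigcap_(x in [set` s]) (w x @^-1` B x)) =
     \big[*%E/1%E]_(x <- s) P (w x @^-1` B x)) /\
  (forall (x : int) (B : set R), measurable B -> P (w x @^-1` B) = P (w 0 @^-1` B)).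

(* Position at time n of the nearest-neighbour path started at x0 whose first
   M steps are given by b (true = step +1, false = step -1); n <= M. *)
Definition pos {M : nat} (x0 : int) (b : {ffun 'I_M -> bool}) (n : nat) : int :=
  x0 + \sum_(k < M | (k < n)%N) (if b k then 1 else -1).

Definition path_prob {R : realType} (om : int -> R) {M : nat} (x0 : int)
  (b : {ffun 'I_M -> bool}) : R :=
  \prod_(k < M) (if b k then om (pos x0 b k) else 1 - om (pos x0 b k)).

Definition coincide {d M : nat} (x : 'I_d -> int)
  (B : {ffun 'I_d -> {ffun 'I_M -> bool}}) (n : nat) : bool :=
  [forall i, forall j, pos (x i) (B i) n == pos (x j) (B j) n].

(* Quenched probability P_om^{(x_1..x_d)}[ exists n, N <= n <= M, S^(1)_n = ... = S^(d)_n ]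
   computed from the finite-dimensional distributions (M steps of each independent walk). *)
Definition coinc_prob {R : realType} (om : int -> R) {d : nat} (x : 'I_d -> int)
  (N M : nat) : R :=
  \sum_(B : {ffun 'I_d -> {ffun 'I_M -> bool}} |
          [exists n : 'I_M.+1, (N <= n)%N && coincide x B n])
    \prod_(j < d) path_prob om (x j) (B j).

(* Quenched probability of { S^(1)_n = ... = S^(d)_n for infinitely many n }
   = inf_N sup_M P_om[ exists n in [N, M], coincidence ]  (continuity of measure). *)
Definition quenched_io {R : realType} (om : int -> R) {d : nat} (x : 'I_d -> int) : \bar R :=
  ereal_inf [set ereal_sup [set (coinc_prob om x N M)%:E | M in [set: nat]]
            | N in [set: nat]].

(* Main.v *)
Require Import Defs.
From HB Require Import structures.
From mathcomp Require Import all_boot all_order all_algebra.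
From mathcomp Require Import all_classical all_reals all_analysis measurable_realfun.
From mathcomp Require Import ring lra zify.
Import Order.TTheory GRing.Theory Num.Theory.
Import numFieldNormedType.Exports.
Local Open Scope classical_set_scope.
Local Open Scope ring_scope.

(* One walker suffices: given the environment the walkers are independent, so if for some
   site b and time n each of them is at b at time n with probability at least c, then they
   all meet at b with probability at least c^d.  If c does not depend on the starting
   points, repeating the attempt gives infinitely many meetings almost surely.

   Let V be the potential, with increments log rho.  By reversibility and Cauchy-Schwarz, the
   probability of being back at b at time 2j is at least pi(b) P(S_j in A)^2 / pi(A), where pi
   is the reversible measure.  So it is enough that b be the bottom of a valley A carrying
   no more than a constant times the mass of b, that the mean time to reach b be at most a
   fraction of some H, and that the barrier to the right of b be of size e^(V - V(b)) >= H.

   As E(rho^kappa) = 1 with kappa < 1, the barrier to the right of a site exceeds H with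
   probability of order H^(-kappa), while the mean time spent to the left of m ~ H^kappa
   sites is of order H: here E(rho) > 1 turns e^V stopped at level H into a martingale
   estimate.  Hence (Bonferroni) a block of about H^kappa sites contains a suitable valley
   with probability bounded below; taking disjoint, rapidly growing blocks, for which the
   uniform ellipticity makes the influence of the earlier blocks negligible, infinitely
   many of them do. *)

(** * Reduction to a uniform lower bound for one meeting *)

(** The sums of e^V that measure a valley have unusable means, since E(rho) > 1. They are therefore
    measured through y = rho^(kappa/2). As E(y) < 1, products of y have geometrically small means
    and Markov's inequality bounds their sums by a constant; as q = 2/kappa >= 1, the inequality sum
    a^q <= (sum a)^q carries these bounds back to e^V. As E(y^2) = E(rho^kappa) = 1, the squared
    products form a martingale, which gives both bounds of order h^-2 = (h^q)^(-kappa) for a barrier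
    of height h^q.

    Three scales are tied together by h^q = 2 tm: the barrier confines a walker for tm steps, the
    approach is crossed in a small multiple of tm, and the block offers a small multiple of h^2
    candidate bottoms. The success probability p is fixed by these small multiples alone; the depth
    required below the past and the minimal time are chosen afterwards and may depend on the start n
    of the block. Hence an influence of the past that is exponential in n is harmless. The time of a
    meeting attempt depends on the starting points; only its success probability must be uniform. *)

Definition step_val (c : bool) : int := if c then 1 else -1.

Definition fcons {M : nat} (c : bool) (b : {ffun 'I_M -> bool}) : {ffun 'I_M.+1 -> bool} :=
  [ffun k => if unlift ord0 k is Some k' then b k' else c].

Lemma fcons0 M c (b : {ffun 'I_M -> bool}) : fcons c b ord0 = c.
Proof. by rewrite ffunE unlift_none. Qed.

Lemma fconsS M c (b : {ffun 'I_M -> bool}) k : fcons c b (lift ord0 k) = b k.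
Proof. by rewrite ffunE liftK. Qed.

Lemma pos0 M x (b : {ffun 'I_M -> bool}) : pos x b 0 = x.
Proof. by rewrite /pos big_pred0 ?addr0. Qed.

Lemma pos_fcons M x c (b : {ffun 'I_M -> bool}) n :
  pos x (fcons c b) n.+1 = pos (x + step_val c) b n.
Proof.
rewrite /pos big_mkcond big_ord_recl /= fcons0 -addrA; congr (_ + _).
rewrite /step_val; congr (_ + _); rewrite [RHS]big_mkcond.
by apply: eq_bigr => k _; rewrite fconsS /bump /= ltnS.
Qed.

Section joint_walk.
Context {R : realType} (om : int -> R) (d : nat).
Hypothesis om01 : forall z, 0 < om z < 1.

Definition step_prob (z : int) (c : bool) : R := if c then om z else 1 - om z.

Lemma step_prob_ge0 z c : 0 <= step_prob z c.
Proof. by rewrite /step_prob; case: c; have := om01 z; lra. Qed.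

Lemma path_prob_fcons M x c (b : {ffun 'I_M -> bool}) :
  path_prob om x (fcons c b) = step_prob x c * path_prob om (x + step_val c) b.
Proof.
rewrite /path_prob big_ord_recl fcons0 pos0 -/(step_prob x c); congr (_ * _).
by apply: eq_bigr => k _; rewrite fconsS /= pos_fcons.
Qed.

Definition move (x : 'I_d -> int) (c : {ffun 'I_d -> bool}) : 'I_d -> int :=
  fun j => x j + step_val (c j).

Definition move_prob (x : 'I_d -> int) (c : {ffun 'I_d -> bool}) : R :=
  \prod_(j < d) step_prob (x j) (c j).

Lemma move_prob_ge0 x c : 0 <= move_prob x c.
Proof. by apply: prodr_ge0 => j _; apply: step_prob_ge0. Qed.

(** Independence of the walkers in one step: distributivity turns the sum over joint moves into a
    product over walkers. *)
Lemma sum_move_prod (x : 'I_d -> int) (F : 'I_d -> bool -> R) :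
  \sum_c move_prob x c * \prod_j F j (c j) =
  \prod_j (om (x j) * F j true + (1 - om (x j)) * F j false).
Proof.
transitivity (\sum_(c : {ffun 'I_d -> bool}) \prod_j (step_prob (x j) (c j) * F j (c j))).
  by apply: eq_bigr => c _; rewrite /move_prob -big_split.
rewrite -(bigA_distr_bigA (fun j c => step_prob (x j) c * F j c)) /=.
by apply: eq_bigr => j _; rewrite big_bool.
Qed.

Lemma sum_move_prob x : \sum_c move_prob x c = 1.
Proof.
rewrite -[RHS](_ : \prod_(j < d) (om (x j) * 1 + (1 - om (x j)) * 1) = 1).
  by rewrite -(sum_move_prod x (fun _ _ => 1)); apply: eq_bigr => c _;
    rewrite big1 ?mulr1.
by apply: big1 => j _; ring.
Qed.

Definition jcons {M} (c : {ffun 'I_d -> bool}) (B : {ffun 'I_d -> {ffun 'I_M -> bool}}) :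
  {ffun 'I_d -> {ffun 'I_M.+1 -> bool}} := [ffun j => fcons (c j) (B j)].

Lemma sum_jcons M (F : {ffun 'I_d -> {ffun 'I_M.+1 -> bool}} -> R) :
  \sum_B F B = \sum_c \sum_B F (jcons c B).
Proof.
rewrite pair_big /=.
pose dec (B : {ffun 'I_d -> {ffun 'I_M.+1 -> bool}}) :=
  ([ffun j => B j ord0], [ffun j => [ffun k => B j (lift ord0 k)]]).
rewrite (reindex (fun p : {ffun 'I_d -> bool} * {ffun 'I_d -> {ffun 'I_M -> bool}} =>
  jcons p.1 p.2)) //=.
exists dec => [[c B] _ | B _].
  congr pair; apply/ffunP => j; first by rewrite !(ffunE, fcons0).
  by rewrite ffunE; apply/ffunP => k; rewrite ffunE ffunE fconsS.
apply/ffunP => j; apply/ffunP => k; rewrite ffunE.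
by case: (unliftP ord0 k) => [k'|] ->; rewrite ?fcons0 ?fconsS !ffunE.
Qed.

Lemma prod_path_prob_jcons M x c (B : {ffun 'I_d -> {ffun 'I_M -> bool}}) :
  \prod_j path_prob om (x j) (jcons c B j) =
  move_prob x c * \prod_j path_prob om (move x c j) (B j).
Proof.
rewrite -big_split /=; apply: eq_bigr => j _.
by rewrite ffunE path_prob_fcons.
Qed.

Definition allsame (x : 'I_d -> int) := [forall i, forall j, x i == x j].

Lemma coincide0 M x (B : {ffun 'I_d -> {ffun 'I_M -> bool}}) :
  coincide x B 0 = allsame x.
Proof. by apply: eq_forallb => i; apply: eq_forallb => j; rewrite !pos0. Qed.

Lemma coincide_jcons M x c (B : {ffun 'I_d -> {ffun 'I_M -> bool}}) n :
  coincide x (jcons c B) n.+1 = coincide (move x c) B n.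
Proof.
by apply: eq_forallb => i; apply: eq_forallb => j; rewrite !ffunE !pos_fcons.
Qed.

Lemma sum_prod_path_prob M x :
  \sum_(B : {ffun 'I_d -> {ffun 'I_M -> bool}}) \prod_j path_prob om (x j) (B j) = 1.
Proof.
elim: M x => [|M IH] x.
  rewrite -(bigA_distr_bigA (fun j b => path_prob om (x j) b)) /=.
  apply: big1 => j _; rewrite (eq_bigr (fun=> 1)) => [|b _].
    by rewrite sumr_const card_ffun card_ord expn0.
  by rewrite /path_prob big_ord0.
rewrite sum_jcons -[RHS](sum_move_prob x); apply: eq_bigr => c _.
under eq_bigr do rewrite prod_path_prob_jcons.
by rewrite -mulr_sumr IH mulr1.
Qed.

Lemma coinc_probE (x : 'I_d -> int) N M : coinc_prob om x N M =
  \sum_(B : {ffun 'I_d -> {ffun 'I_M -> bool}})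
   [exists n : 'I_M.+1, (N <= n)%N && coincide x B n]%:R * \prod_j path_prob om (x j) (B j).
Proof.
rewrite /coinc_prob big_mkcond /=; apply: eq_bigr => B _.
by case: ifP; rewrite ?mul1r ?mul0r.
Qed.

Lemma exists_ord_recl M (p : nat -> bool) :
  [exists n : 'I_M.+1, p n] = p 0%N || [exists n : 'I_M, p n.+1].
Proof.
apply/existsP/orP => [[n]|[p0|/existsP[n pn]]].
- case: (unliftP ord0 n) => [k|] -> pn; last by left.
  by right; apply/existsP; exists k.
- by exists ord0.
- by exists (lift ord0 n).
Qed.

(** Markov property at time one. The bound [N.+1] excludes time 0, so nothing is asked of the
    starting positions, in contrast to [coinc_prob0S]. *)
Lemma coinc_probSS (x : 'I_d -> int) N M : coinc_prob om x N.+1 M.+1 =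
  \sum_c move_prob x c * coinc_prob om (move x c) N M.
Proof.
rewrite coinc_probE sum_jcons; apply: eq_bigr => c _.
rewrite coinc_probE mulr_sumr; apply: eq_bigr => B _.
rewrite prod_path_prob_jcons mulrCA; congr (_ * (_ * _)); congr (nat_of_bool _)%:R.
rewrite (exists_ord_recl _ (fun n => (N.+1 <= n)%N && coincide x (jcons c B) n)) /=.
by apply: eq_existsb => n; rewrite ltnS coincide_jcons.
Qed.

Lemma coinc_prob_same (x : 'I_d -> int) M : allsame x -> coinc_prob om x 0 M = 1.
Proof.
move=> sx; rewrite coinc_probE -[RHS](sum_prod_path_prob M x); apply: eq_bigr => B _.
suff -> : [exists n : 'I_M.+1, (0 <= n)%N && coincide x B n] by rewrite mul1r.
by apply/existsP; exists ord0; rewrite coincide0.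
Qed.

Lemma coinc_prob0S (x : 'I_d -> int) M : ~~ allsame x -> coinc_prob om x 0 M.+1 =
  \sum_c move_prob x c * coinc_prob om (move x c) 0 M.
Proof.
move=> /negbTE sx; rewrite coinc_probE sum_jcons; apply: eq_bigr => c _.
rewrite coinc_probE mulr_sumr; apply: eq_bigr => B _.
rewrite prod_path_prob_jcons mulrCA; congr (_ * (_ * _)); congr (nat_of_bool _)%:R.
rewrite (exists_ord_recl _ (fun n => (0 <= n)%N && coincide x (jcons c B) n)) /=.
rewrite coincide0 sx /=.
by apply: eq_existsb => n; rewrite coincide_jcons.
Qed.

Lemma coinc_prob00 (x : 'I_d -> int) : ~~ allsame x -> coinc_prob om x 0 0 = 0.
Proof.
move=> /negbTE sx; rewrite coinc_probE big1 // => B _.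
by rewrite (exists_ord_recl _ (fun n => (0 <= n)%N && coincide x B n)) /= coincide0 sx /=;
  case: existsP => [[[]]//|]; rewrite mul0r.
Qed.

Lemma coinc_probS0 (x : 'I_d -> int) N : coinc_prob om x N.+1 0 = 0.
Proof.
rewrite coinc_probE big1 // => B _.
by rewrite (exists_ord_recl _ (fun n => (N < n)%N && coincide x B n)) /=;
  case: existsP => [[[]]//|]; rewrite mul0r.
Qed.

Lemma coinc_prob_ge0 (x : 'I_d -> int) N M : 0 <= coinc_prob om x N M.
Proof.
apply: sumr_ge0 => B _; apply: prodr_ge0 => j _; apply: prodr_ge0 => k _.
exact: step_prob_ge0.
Qed.

Lemma coinc_prob_le1 (x : 'I_d -> int) N M : coinc_prob om x N M <= 1.
Proof.
rewrite coinc_probE -[leRHS](sum_prod_path_prob M x); apply: ler_sum => B _.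
apply: ler_piMl; last by rewrite lern1 leq_b1.
by apply: prodr_ge0 => j _; apply: prodr_ge0 => k _; exact: step_prob_ge0.
Qed.

(** * Probability of not meeting, and restarts *)

Definition miss (x : 'I_d -> int) N M := 1 - coinc_prob om x N M.

Lemma miss_le1 (x : 'I_d -> int) N M : miss x N M <= 1.
Proof. by rewrite lerBlDr lerDl coinc_prob_ge0. Qed.

Lemma missSS (x : 'I_d -> int) N M : miss x N.+1 M.+1 = \sum_c move_prob x c * miss (move x c) N M.
Proof.
rewrite /miss coinc_probSS -{1}(sum_move_prob x) -sumrB; apply: eq_bigr => c _.
by rewrite mulrBr mulr1.
Qed.

Lemma miss_same (x : 'I_d -> int) M : allsame x -> miss x 0 M = 0.
Proof. by move=> sx; rewrite /miss coinc_prob_same// subrr. Qed.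

Lemma miss0S (x : 'I_d -> int) M : ~~ allsame x ->
  miss x 0 M.+1 = \sum_c move_prob x c * miss (move x c) 0 M.
Proof.
move=> sx; rewrite /miss coinc_prob0S// -{1}(sum_move_prob x) -sumrB.
by apply: eq_bigr => c _; rewrite mulrBr mulr1.
Qed.

Lemma missS (x : 'I_d -> int) N M : miss x N M.+1 <= miss x N M.
Proof.
elim: M N x => [|M IH] [|N] x.
- have [sx|sx] := boolP (allsame x); first by rewrite !miss_same.
  by rewrite [leRHS]/miss coinc_prob00// subr0 miss_le1.
- by rewrite [leRHS]/miss coinc_probS0 subr0 miss_le1.
- have [sx|sx] := boolP (allsame x); first by rewrite !miss_same.
  rewrite !miss0S//; apply: ler_sum => c _.
  by rewrite ler_wpM2l ?move_prob_ge0.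
- rewrite !missSS//; apply: ler_sum => c _.
  by rewrite ler_wpM2l ?move_prob_ge0.
Qed.

Lemma miss_le (x : 'I_d -> int) N M M' : (M <= M')%N -> miss x N M' <= miss x N M.
Proof.
move=> /subnK <-; elim: (M' - M)%N => [|k IH] //=.
by rewrite addSn (le_trans (missS _ _ _)).
Qed.

Definition samepar (x : 'I_d -> int) := forall i j, (2 %| x i - x j)%Z.

Lemma samepar_move (x : 'I_d -> int) c : samepar x -> samepar (move x c).
Proof.
move=> sx i j; have := sx i j; rewrite /move /step_val.
by case: (c i); case: (c j); lia.
Qed.

Lemma miss_later (del : R) N :
  (forall y, samepar y -> exists M, miss y 0 M <= del) ->
  forall y, samepar y -> exists M, miss y N M <= del.
Proof.
move=> H0; elim: N => [//|N IH] y sy.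
have /choice[f fP] : forall c, exists M, miss (move y c) N M <= del.
  by move=> c; apply: IH; exact: samepar_move.
(* The horizon depends on the first move. There are finitely many moves and [miss] decreases in the
   horizon, so the largest one serves all. *)
exists (\max_c f c).+1; rewrite missSS.
rewrite (le_trans (y := \sum_c move_prob y c * del)) //; last first.
  by rewrite -mulr_suml sum_move_prob mul1r.
apply: ler_sum => c _; rewrite ler_wpM2l ?move_prob_ge0//.
by rewrite (le_trans _ (fP c))// miss_le// (leq_bigmax_cond (F := f)).
Qed.

(** Markov property at time [M1] on the event of no meeting so far: a fresh attempt from the current
    positions fails with probability at most [del], uniformly, although its length is not
    uniform. *)
Lemma miss_restart (del : R) : 
  (forall y, samepar y -> exists M, miss y 0 M <= del) ->
  forall M1 y, samepar y -> exists M, miss y 0 (M1 + M) <= miss y 0 M1 * del.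
Proof.
move=> H0; elim=> [|M1 IH] y sy.
  have [sx|sx] := boolP (allsame y).
    by exists 0%N; rewrite !miss_same ?mul0r.
  have [M HM] := H0 y sy; exists M.
  by rewrite add0n [miss y 0 0]/miss coinc_prob00// subr0 mul1r.
have [sx|sx] := boolP (allsame y).
  by exists 0%N; rewrite !miss_same ?mul0r.
have /choice[f fP] : forall c, exists M, miss (move y c) 0 (M1 + M) <= miss (move y c) 0 M1 * del.
  by move=> c; apply: IH; exact: samepar_move.
exists (\max_c f c); rewrite addSn !miss0S// mulr_suml.
apply: ler_sum => c _; rewrite -mulrA ler_wpM2l ?move_prob_ge0//.
by rewrite (le_trans _ (fP c))// miss_le// leq_add2l (leq_bigmax_cond (F := f)).
Qed.

(** By restarts, k successive attempts all fail with probability at most (1 - c)^k. Postponing them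
    beyond time N shows that the supremum over M is 1 for each N. *)
Lemma quenched_io_eq1 (c : R) (x : 'I_d -> int) : 0 < c ->
  (forall y, samepar y -> exists M, c <= coinc_prob om y 0 M) ->
  samepar x -> quenched_io om x = 1%E.
Proof.
move=> c0 Hc sx.
have cle1 : c <= 1 by have [M /le_trans] := Hc x sx; apply; exact: coinc_prob_le1.
have Hk k : forall y, samepar y -> exists M, miss y 0 M <= (1 - c) ^+ k.
  elim: k => [|k IH] y sy; first by exists 0%N; rewrite expr0 miss_le1.
  have [M1 HM1] := Hc y sy.
  have [M HM] := miss_restart _ IH M1 _ sy.
  exists (M1 + M)%N; rewrite (le_trans HM)// exprS ler_wpM2r ?exprn_ge0 ?subr_ge0//.
  by rewrite /miss lerB.
have sup1 N : ereal_sup [set (coinc_prob om x N M)%:E | M in [set: nat]] = 1%E.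
  apply/eqP; rewrite eq_le; apply/andP; split.
    by apply: ge_ereal_sup => _ [M _ <-]; rewrite lee_fin coinc_prob_le1.
  apply/lee_addgt0Pr => e e0; rewrite -leeBlDr//.
  have /cvgrPdist_lt /(_ e e0) [k _ Hke] : (fun n => (1 - c) ^+ n) @ \oo --> (0 : R).
    by apply: cvg_expr; rewrite ger0_norm ?subr_ge0//; lra.
  have [M HM] := miss_later _ N (Hk k) _ sx.
  apply: le_ereal_sup_tmp; exists (coinc_prob om x N M)%:E; first by exists M.
  have := Hke k (leqnn _); rewrite sub0r normrN ger0_norm ?exprn_ge0 ?subr_ge0// => H.
  by rewrite -EFinB lee_fin; move: HM; rewrite /miss; lra.
rewrite /quenched_io.
rewrite (_ : (fun N => _) = cst 1%E); first by apply: ereal_inf_cst; apply/set0P; exists 0%N.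
by apply/funext => N; exact: sup1.
Qed.

Fixpoint trans_prob (n : nat) (x y : int) : R :=
  if n is m.+1 then om x * trans_prob m (x + 1) y + (1 - om x) * trans_prob m (x - 1) y
  else (x == y)%:R.

Lemma trans_prob_ge0 n x y : 0 <= trans_prob n x y.
Proof.
elim: n x => [|n IH] x //=.
by have := om01 x => ?; apply: addr_ge0; apply: mulr_ge0; rewrite ?IH//; lra.
Qed.

(** The meeting need not be tracked at [b]: both sides obey the same first-step recursion until the
    walkers coincide, when the right side jumps to 1. *)
Lemma coinc_prob_ge_prod n (x : 'I_d -> int) b :
  \prod_j trans_prob n (x j) b <= coinc_prob om x 0 n.
Proof.
have prod_le1 m (y : 'I_d -> int) : \prod_j trans_prob m (y j) b <= 1.
  apply: prodr_ile1 => j _; rewrite trans_prob_ge0 /=; elim: m (y j) => [|m IH] z /=.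
    by rewrite lern1 leq_b1.
  by have := IH (z + 1); have := IH (z - 1); have := om01 z; nra.
elim: n x => [|n IH] x.
  have [sx|sx] := boolP (allsame x); first by rewrite coinc_prob_same.
  rewrite coinc_prob00//; case/forallPn : sx => i /forallPn[j] /= xij.
  have [xib|xib] := eqVneq (x i) b.
    by rewrite (bigD1 j)//= -xib eq_sym (negbTE xij) mul0r.
  by rewrite (bigD1 i)//= (negbTE xib) mul0r.
have [sx|sx] := boolP (allsame x); first by rewrite coinc_prob_same.
rewrite coinc_prob0S//= -(sum_move_prod x (fun j c => trans_prob n (x j + step_val c) b)).
apply: ler_sum => c _; rewrite ler_wpM2l ?move_prob_ge0//.
Qed.
End joint_walk.

(** * The quenched walk of one particle *)

Section quenched_walk.
Context {R : realType} (om E : int -> R).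
Hypothesis om01 : forall z, 0 < om z < 1.
Hypothesis E_gt0 : forall z, 0 < E z.
Hypothesis balance : forall z, om z * E z = (1 - om z) * E (z - 1).

Local Notation p := (trans_prob om).
(* The reversible measure of the walk is [z |-> (om z * E z)^-1]. *)
Local Notation c z := (om z * E z).

Lemma c_gt0 z : 0 < c z.
Proof. by have := om01 z => ?; rewrite mulr_gt0//; lra. Qed.

Lemma trans_prob_last n x y :
  p n.+1 x y = p n x (y - 1) * om (y - 1) + p n x (y + 1) * (1 - om (y + 1)).
Proof.
elim: n x => [|n IH] x; last first.
  have -> : p n.+2 x y = om x * p n.+1 (x + 1) y + (1 - om x) * p n.+1 (x - 1) y by [].
  by rewrite !IH /=; ring.
rewrite /= [x + 1 == y](_ : _ = (x == y - 1)); last by lia.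
rewrite [x - 1 == y](_ : _ = (x == y + 1)); last by lia.
by congr (_ + _); case: eqP => [->|_]; rewrite ?mulr1 ?mul1r ?mulr0 ?mul0r.
Qed.

(** Detailed balance lifted to n steps; the induction expands one side by its first step and the
    other by its last. *)
Lemma trans_prob_reversible n x y : p n x y * c y = p n y x * c x.
Proof.
elim: n x => [|n IH] x.
  by rewrite /= eq_sym; case: eqP => [->|_]//; rewrite !mul0r.
rewrite [X in _ = X * _]trans_prob_last /=.
have b1 : om x * c (x + 1) = (1 - om (x + 1)) * c x.
  by rewrite balance addrK; ring.
have b2 : (1 - om x) * c (x - 1) = om (x - 1) * c x.
  by rewrite (balance x); ring.
have -> : (om x * p n (x + 1) y + (1 - om x) * p n (x - 1) y) * c y =
  om x * (p n (x + 1) y * c y) + (1 - om x) * (p n (x - 1) y * c y) by ring.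
rewrite !IH mulrCA b1 [(1 - om x) * _]mulrCA b2; ring.
Qed.

Lemma trans_prob_concat (s : seq int) m n x y : uniq s ->
  \sum_(z <- s) p m x z * p n z y <= p (m + n) x y.
Proof.
move=> us; elim: m x => [|m IH] x /=.
  rewrite add0n; have [xs|xs] := boolP (x \in s).
    rewrite (bigD1_seq x)//= eqxx mul1r big1 ?addr0// => z /negbTE.
    by rewrite eq_sym => ->; rewrite mul0r.
  rewrite big_seq big1 ?trans_prob_ge0// => z zs.
  by case: eqP => [xz|]; rewrite ?mul0r//; rewrite -xz (negbTE xs) in zs.
have := om01 x => ox.
apply: le_trans (lerD (ler_wpM2l _ (IH (x + 1))) (ler_wpM2l _ (IH (x - 1)))); [|lra..].
rewrite !mulr_sumr -big_split /=; apply: ler_sum => z _.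
by rewrite mulrDl !mulrA.
Qed.

(* Cauchy-Schwarz in the tangent form [a^2/q >= 2 la a - la^2 q], with [la = 1/(2 C)]. *)
Lemma trans_prob_return (s : seq int) n b (C : R) : uniq s -> 0 < C ->
  2^-1 <= \sum_(z <- s) p n b z ->
  \sum_(z <- s) c b / c z <= C ->
  (4 * C)^-1 <= p (n + n) b b.
Proof.
move=> us C0 Hp Hc.
apply: le_trans (trans_prob_concat _ n n b b us).
have Hz z : C^-1 * p n b z - (4 * C ^+ 2)^-1 * (c b / c z) <= p n b z * p n z b.
  have cb := c_gt0 b; have cz := c_gt0 z.
  have -> : p n z b = p n b z / (c b / c z).
    apply: (mulIf (lt0r_neq0 cb)).
    rewrite trans_prob_reversible; move: (c b) (c z) cb cz => cb cz cb0 cz0.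
    by field; rewrite !lt0r_neq0.
  have q0 : 0 < c b / c z by rewrite divr_gt0.
  move: (c b / c z) q0 (p n b z) => q q0 a.
  rewrite -subr_ge0.
  have -> : a * (a / q) - (C^-1 * a - (4 * C ^+ 2)^-1 * q) =
    (a - q / (2 * C)) ^+ 2 / q by field; rewrite !lt0r_neq0.
  by rewrite divr_ge0 ?sqr_ge0// ltW.
apply: le_trans (ler_sum _ (fun z _ => Hz z)).
rewrite sumrB -[X in X - _]mulr_sumr -[X in _ - X]mulr_sumr.
have C2 : 0 < (4 * C ^+ 2)^-1 by rewrite invr_gt0 mulr_gt0// exprn_gt0.
have h1 := ler_wpM2l (ltW C2) Hc.
have Ci : 0 < C^-1 by rewrite invr_gt0.
have h2 := ler_wpM2l (ltW Ci) Hp.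
have e1 : (4 * C ^+ 2)^-1 * C = C^-1 / 4 by field; rewrite lt0r_neq0.
have e2 : (4 * C)^-1 = C^-1 / 4 by field; rewrite lt0r_neq0.
by rewrite e2; lra.
Qed.

Definition window (l : int) (len : nat) : seq int := [seq l + k%:Z | k <- iota 0 len].

Lemma uniq_window l len : uniq (window l len).
Proof. by rewrite map_inj_uniq ?iota_uniq// => i j; lia. Qed.

Lemma mem_window (l : int) len (z : int) : l <= z < l + len%:Z -> z \in window l len.
Proof.
move=> lz; apply/mapP; exists (absz (z - l)%R); last by lia.
by rewrite mem_iota; lia.
Qed.

Lemma sum_window l len (F : int -> R) :
  \sum_(z <- window l len) F z = \sum_(k < len) F (l + k%:Z).
Proof. by rewrite big_map -val_enum_ord big_map big_enum. Qed.

(** * Confinement by the barrier to the right of the bottom *)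

Section barrier.
Variables (b : int) (i0 : nat).

(** The scale function of the walk right of [b], flattened to 0 on the left and divided by the
    weight of the edge at [b + i0], so that it is at least 1 beyond that site. *)
Definition psi (x : int) : R :=
  if b <= x then (\sum_(i < (absz (x - b)%R)) E (b + i%:Z)) / E (b + i0%:Z) else 0.

Lemma psi_le (x : int) : x <= b -> psi x = 0.
Proof.
rewrite /psi => xb; case: ifP => // bx; have -> : x = b by lia.
by rewrite subrr absz0 big_ord0 mul0r.
Qed.

Lemma psiS (x : int) : b <= x -> psi (x + 1) = psi x + E x / E (b + i0%:Z).
Proof.
move=> bx; rewrite /psi bx (_ : b <= x + 1)//; last by lia.
have -> : (absz (x + 1 - b)%R) = (absz (x - b)%R).+1 by lia.
by rewrite big_ord_recr /= mulrDl; congr (_ + E _ / _); lia.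
Qed.

Lemma psi_ge0 x : 0 <= psi x.
Proof.
rewrite /psi; case: ifP => // _; rewrite divr_ge0 ?(ltW (E_gt0 _))//.
by apply: sumr_ge0 => i _; rewrite ltW.
Qed.

Lemma psi_ge1 (x : int) : b + i0%:Z < x -> 1 <= psi x.
Proof.
move=> bx; rewrite /psi ifT; last by lia.
have lti : (i0 < absz (x - b)%R)%N by lia.
rewrite ler_pdivlMr ?E_gt0// mul1r (bigD1 (Ordinal lti))//= lerDl.
by apply: sumr_ge0 => i _; rewrite ltW.
Qed.

(** [psi] is harmonic away from [b]; the kink at [b] is the only source of drift, worth
    [om b * E b / E (b + i0)]. *)
Lemma psi_step x : om x * psi (x + 1) + (1 - om x) * psi (x - 1) <=
  psi x + E b / E (b + i0%:Z).
Proof.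
have := om01 x => ox.
have [xb|xb|->] := ltgtP x b; last 1 first.
- rewrite psiS// (psi_le b)// psi_le ?mulr0 ?addr0 ?add0r; last by lia.
  have q0 : 0 < E b / E (b + i0%:Z) by rewrite divr_gt0.
  by rewrite ger_pMl//; have := om01 b; lra.
- rewrite !psi_le ?mulr0 ?addr0 ?add0r; try lia.
  by rewrite divr_ge0// ltW.
- rewrite psiS; last by lia.
  have := @psiS (x - 1); rewrite subrK => -> //; last by lia.
  have q0 : 0 < E b / E (b + i0%:Z) by rewrite divr_gt0.
  suff : om x * (E x / E (b + i0%:Z)) = (1 - om x) * (E (x - 1) / E (b + i0%:Z)) by nra.
  by rewrite !mulrA balance.
Qed.

(** [psi] at the walker grows in mean by at most [E b / E (b + i0)] per step and is at least 1 to
    the right of the window, so its mean bounds the probability of being there. The left end cannot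
    be crossed in n steps from [l + n] or beyond. *)
Lemma stay_left (l : int) len n (x : int) : l + len%:Z = b + i0%:Z + 1 -> l + n%:Z <= x ->
  1 - psi x - n%:R * (E b / E (b + i0%:Z)) <= \sum_(z <- window l len) p n x z.
Proof.
move=> Hl; have q0 : 0 < E b / E (b + i0%:Z) by rewrite divr_gt0.
elim: n x => [|n IH] x lx.
  rewrite mul0r subr0; have [xr|xr] := ltP x (l + len%:Z).
    apply: (@le_trans _ _ 1); first by rewrite lerBlDr lerDl psi_ge0.
    rewrite (bigD1_seq x) ?uniq_window ?mem_window//=; last by lia.
    by rewrite eqxx lerDl sumr_ge0.
  have : 1 <= psi x by apply: psi_ge1; lia.
  have : 0 <= \sum_(z <- window l len) p 0 x z by apply: sumr_ge0.
  by lra.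
have IH1 := IH (x + 1) ltac:(lia); have IH2 := IH (x - 1) ltac:(lia).
rewrite /= big_split /= -!mulr_sumr.
have := om01 x => ox.
have o1 : 0 <= 1 - om x by lra.
have o2 : 0 <= om x by lra.
have h1 := ler_wpM2l o2 IH1; have h2 := ler_wpM2l o1 IH2.
have := psi_step x; rewrite -natr1 mulrDl mul1r.
set th := E b / _ in q0 h1 h2 *; lra.
Qed.
End barrier.

(** * Reaching the bottom of the valley *)

Section hitting.
Variable b : int.

Fixpoint hit_prob (n : nat) (y : int) : R :=
  if y == b then 1 else
  if n is m.+1 then om y * hit_prob m (y + 1) + (1 - om y) * hit_prob m (y - 1) else 0.

Lemma hit_prob_target n : hit_prob n b = 1.
Proof. by case: n => [|n] /=; rewrite eqxx. Qed.

Lemma hit_probS n y : y != b ->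
  hit_prob n.+1 y = om y * hit_prob n (y + 1) + (1 - om y) * hit_prob n (y - 1).
Proof. by move=> /negbTE /= ->. Qed.

Lemma hit_prob01 n y : 0 <= hit_prob n y <= 1.
Proof.
elim: n y => [|n IH] y; have [->|yb] := eqVneq y b; rewrite ?hit_prob_target ?lexx ?ler01//.
  by rewrite /= (negbTE yb) lexx ler01.
by rewrite hit_probS//; have := IH (y + 1); have := IH (y - 1); have := om01 y; nra.
Qed.

Lemma hit_prob_mono n m y : (n <= m)%N -> hit_prob n y <= hit_prob m y.
Proof.
elim: n m y => [|n IH] [|m] y // nm; have [->|yb] := eqVneq y b; rewrite ?hit_prob_target//.
  by rewrite {1}/hit_prob (negbTE yb); case/andP: (hit_prob01 m.+1 y).
rewrite !hit_probS//; have := om01 y => ?.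
by rewrite lerD// ler_wpM2l ?IH//; lra.
Qed.

(** Strong Markov property at the hitting time of [b]. The parity assumption makes the time left
    after hitting even, so only even return times matter. *)
Lemma trans_prob_ge_hit (C : R) N n y : 0 <= C ->
  (forall j, (j + j <= N)%N -> C <= p (j + j) b b) ->
  (n <= N)%N -> (2 %| n%:Z - (b - y))%Z -> C * hit_prob n y <= p n y b.
Proof.
move=> C0 HC; elim: n y => [|n IH] y nN par.
  have [->|yb] := eqVneq y b; last by rewrite /= (negbTE yb) mulr0.
  by rewrite hit_prob_target mulr1; apply: (HC 0%N).
have [yb|yb] := eqVneq y b.
  rewrite yb hit_prob_target mulr1.
  have [j nj] : exists j, n.+1 = (j + j)%N by exists (n.+1)./2; rewrite yb in par; lia.
  by rewrite nj; apply: HC; lia.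
rewrite hit_probS//= mulrDr.
have := om01 y => oy.
have h1 := IH (y + 1) ltac:(lia) ltac:(lia).
have h2 := IH (y - 1) ltac:(lia) ltac:(lia).
by rewrite lerD// mulrCA ler_wpM2l//; lra.
Qed.

(** The left side is the mean of the hitting time capped at n, and [u] is a supersolution of the
    equation for mean hitting times. It need only be one strictly between [l] and [b], since a start
    at [l + n] or beyond does not see the left end. *)
Lemma sum_miss_hit_le (u : int -> R) (l : int) n (y : int) :
  (forall y, l < y < b -> 1 + om y * u (y + 1) + (1 - om y) * u (y - 1) <= u y) ->
  (forall y, l <= y <= b -> 0 <= u y) ->
  l + n%:Z <= y <= b -> \sum_(i < n) (1 - hit_prob i y) <= u y.
Proof.
move=> Hu u0; elim: n y => [|n IH] y yl.
  by rewrite big_ord0 u0//; lia.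
have [yb|yb] := eqVneq y b.
  rewrite yb big1 ?u0//; first by lia.
  by move=> i _; rewrite hit_prob_target subrr.
rewrite big_ord_recl /= (negbTE yb) subr0.
apply: le_trans (Hu y _); last by lia.
have := om01 y => oy.
rewrite -addrA lerD2l.
apply: le_trans (lerD (ler_wpM2l _ (IH (y + 1) _)) (ler_wpM2l _ (IH (y - 1) _))); try lra; try lia.
rewrite !mulr_sumr -big_split /=; apply: ler_sum => i _.
by rewrite /bump /=; lra.
Qed.
End hitting.

(** The inner sum is the mean time to pass from [l + z] to [l + z + 1] when left steps at [l] are
    replaced by pauses; the outer sum adds these passages from [l + a] to [l + B]. *)
Definition hit_time (l : int) (B a : nat) : R :=
  \sum_(a <= z < B) \sum_(k < z.+1) E (l + z%:Z) / c (l + k%:Z).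

Lemma hit_prob_ge_half l B a n : (n <= a)%N -> (a <= B)%N ->
  (0 < n)%N -> 2 * hit_time l B a <= n%:R -> 2^-1 <= hit_prob (l + B%:Z) n (l + a%:Z).
Proof.
move=> na aB n0 Hn.
pose D z := \sum_(k < z.+1) E (l + z%:Z) / c (l + k%:Z).
have D0 z : 0 <= D z by apply: sumr_ge0 => k _; rewrite divr_ge0// ltW ?c_gt0.
pose u y := hit_time l B (absz (y - l)%R).
have Hu : \sum_(i < n) (1 - hit_prob (l + B%:Z) i (l + a%:Z)) <= hit_time l B a.
  have -> : hit_time l B a = u (l + a%:Z) by rewrite /u addrAC subrr add0r.
  apply: (@sum_miss_hit_le _ u l) => [y yl|y yl|]; last by lia.
    have [k ky] : exists k, y = l + k.+1%:Z by exists (absz (y - l)%R).-1; lia.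
    rewrite /u ky.
    have -> : (absz (l + k.+1%:Z + 1 - l)%R) = k.+2 by lia.
    have -> : (absz (l + k.+1%:Z - 1 - l)%R) = k by lia.
    have -> : (absz (l + k.+1%:Z - l)%R) = k.+1 by lia.
    rewrite /hit_time [X in (1 - _) * X]big_ltn; last by lia.
    rewrite ![\sum_(k.+1 <= _ < _) _]big_ltn; try lia.
    rewrite -/(D k) -/(D k.+1).
    have oy := om01 (l + k.+1%:Z).
    suff : om (l + k.+1%:Z) * D k.+1 = 1 + (1 - om (l + k.+1%:Z)) * D k by lra.
    rewrite {1}/D big_ord_recr /= mulrDr addrC; congr (_ + _).
      have := om01 (l + k.+1%:Z) => ?; have := E_gt0 (l + k.+1%:Z) => ?.
      by field; rewrite !lt0r_neq0//; lra.
    rewrite /D !mulr_sumr; apply: eq_bigr => i _.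
    rewrite !mulrA balance; congr (_ * E _ / _); lia.
  by apply: sumr_ge0 => z _; exact: D0.
set g := hit_prob (l + B%:Z) in Hu *.
(* Markov's inequality for the hitting time: each of the n summands is at least the probability of
   not having hit by time n. *)
have : n%:R * (1 - g n (l + a%:Z)) <= hit_time l B a.
  apply: le_trans Hu.
  have -> : n%:R * (1 - g n (l + a%:Z)) = \sum_(i < n) (1 - g n (l + a%:Z)).
    by rewrite sumr_const card_ord mulr_natl.
  by apply: ler_sum => i _; rewrite lerB// hit_prob_mono// ltnW.
have : 0 < n%:R :> R by rewrite ltr0n.
nra.
Qed.

(** The walk hits the bottom within n steps with probability at least 1/2, and each even return time
    up to [t] has probability at least 1/(4C). The condition [t <= a] keeps the left end out of
    play. *)
Lemma trans_prob_ge_valley l B a i0 n t (C : R) :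
  (t <= a <= B)%N -> (0 < n <= t)%N -> (2 %| n%:Z - (B%:Z - a%:Z))%Z -> 0 < C ->
  t%:R * (E (l + B%:Z) / E (l + B%:Z + i0%:Z)) <= 2^-1 ->
  \sum_(k < (B + i0).+1) c (l + B%:Z) / c (l + k%:Z) <= C ->
  2 * hit_time l B a <= n%:R ->
  (8 * C)^-1 <= p n (l + a%:Z) (l + B%:Z).
Proof.
move=> taB nt par C0 Hbar HC Hhit.
have HR j : (j + j <= t)%N -> (4 * C)^-1 <= p (j + j) (l + B%:Z) (l + B%:Z).
  move=> jt; apply: (@trans_prob_return (window l (B + i0).+1)) => //.
  - exact: uniq_window.
  - apply: le_trans (@stay_left (l + B%:Z) i0 l (B + i0).+1 j (l + B%:Z) _ _); [|lia..].
    rewrite psi_le//.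
    have : 0 < E (l + B%:Z) / E (l + B%:Z + i0%:Z) by rewrite divr_gt0.
    have : (j%:R : R) <= t%:R by rewrite ler_nat; lia.
    by nra.
  - by rewrite sum_window.
have C4 : 0 <= (4 * C)^-1 by rewrite invr_ge0 mulr_ge0// ltW.
apply: le_trans (@trans_prob_ge_hit _ (4 * C)^-1 t n (l + a%:Z) C4 HR _ _); [|lia..].
have -> : (8 * C)^-1 = (4 * C)^-1 * 2^-1 by field; rewrite lt0r_neq0.
by rewrite ler_wpM2l// hit_prob_ge_half//; lia.
Qed.

End quenched_walk.

(** * Independence of disjoint sets of sites *)

Definition cylinders {d0 : measure_display} {T : measurableType d0} {R : realType}
    (w : int -> T -> R) (I : set int) : set (set T) :=
  [set A | exists s B, [/\ uniq s, forall x, x \in s -> I x, forall x, measurable (B x) &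
    A = \bigcap_(x in [set` s]) (w x @^-1` B x)]].

(** The points of T with the sigma-algebra of the sites in [I]: depending on these sites only
    becomes ordinary measurability on this type. *)
Definition sigma_on {d0 : measure_display} {T : measurableType d0} {R : realType}
    (w : int -> T -> R) (I : set int) := g_sigma_algebraType (cylinders w I).

Section independence.
Context {d0 : measure_display} {T : measurableType d0} {R : realType}.
Context (P : probability T R) (w : int -> T -> R).
Hypothesis hiid : iid_family P w.

Local Notation cyl := (cylinders w).
Local Notation FT := (sigma_on w).

Lemma measurable_site x : measurable_fun setT (w x).
Proof. by case: hiid => /(_ x). Qed.

Lemma cyl_measurable I A : cyl I A -> measurable A.
Proof.
move=> [s [B [_ _ mB ->]]].
rewrite bigcap_seq; apply: bigsetI_measurable => x _.
by rewrite -[X in measurable X]setTI; apply: measurable_site.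
Qed.

Lemma cylT I : cyl I setT.
Proof.
exists [::], (fun=> setT); split=> //.
by apply/seteqP; split => t _ //= x; rewrite /= in_nil.
Qed.

Lemma cyl_setI I : setI_closed (cyl I).
Proof.
move=> _ _ [s [B [us sI mB ->]]] [s' [B' [us' s'I mB' ->]]].
exists (undup (s ++ s')), (fun x => (if x \in s then B x else setT) `&`
  (if x \in s' then B' x else setT)); split.
- exact: undup_uniq.
- by move=> x; rewrite mem_undup mem_cat => /orP[/sI|/s'I].
- by move=> x; apply: measurableI; case: ifP.
- apply/seteqP; split => t /=.
    move=> [h h'] x; rewrite /= mem_undup mem_cat => xs; split.
      by case: ifP => // xs1; exact: h.
    by case: ifP => // xs1; exact: h'.
  move=> h; split => x /= xs.
    have /h[] : x \in undup (s ++ s') by rewrite mem_undup mem_cat xs.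
    by rewrite xs.
  have /h[] : x \in undup (s ++ s') by rewrite mem_undup mem_cat xs orbT.
  by rewrite xs.
Qed.

Lemma cyl_mono (I J : set int) : I `<=` J -> cyl I `<=` cyl J.
Proof.
move=> IJ A [s [B [us sI mB ->]]]; exists s, B; split => // x /sI; exact: IJ.
Qed.

Lemma sigma_on_mono (I J : set int) (A : set T) : I `<=` J ->
  measurable (A : set (FT I)) -> measurable (A : set (FT J)).
Proof.
move=> IJ; apply: smallest_sub; first exact: smallest_sigma_algebra.
by move=> B cB; apply: sub_sigma_algebra; exact: (cyl_mono _ _ IJ).
Qed.

Lemma sigma_on_measurable (I : set int) (A : set T) :
  measurable (A : set (FT I)) -> measurable A.
Proof.
apply: smallest_sub; first exact: sigma_algebra_measurable.
by move=> B; exact: cyl_measurable.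
Qed.

Lemma cyl_indep (I J : set int) A B : I `&` J = set0 -> cyl I A -> cyl J B ->
  P (A `&` B) = (P A * P B)%E.
Proof.
move=> IJ [s [BA [us sI mA ->]]] [s' [BB [us' sJ mB ->]]].
have dis x : x \in s -> x \in s' -> False.
  by move=> /sI Ix /sJ Jx; have : (I `&` J) x by []; rewrite IJ.
pose C x := if x \in s then BA x else BB x.
case: hiid => _ [ind _].
have := ind (s ++ s') C.
rewrite cat_uniq us us' /= andbT.
have -> : ~~ has (mem s) s' by apply/hasPn => x xs'; apply/negP => /= xs; exact: (dis x).
have mC x : measurable (C x) by rewrite /C; case: ifP.
move=> /(_ isT mC); rewrite big_cat /=.
rewrite (ind s BA us mA) (ind s' BB us' mB) => h.
have e1 : (\prod_(x <- s) P (w x @^-1` C x) = \prod_(x <- s) P (w x @^-1` BA x))%E.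
  by rewrite !big_seq; apply: eq_bigr => x xs; rewrite /C xs.
have e2 : (\prod_(x <- s') P (w x @^-1` C x) = \prod_(x <- s') P (w x @^-1` BB x))%E.
  rewrite !big_seq; apply: eq_bigr => x xs; rewrite /C ifF//.
  by apply/negP => xs1; exact: (dis x).
rewrite -e1 -e2 -h; congr (P _); apply/seteqP; split => t /=.
  move=> [h1 h2] x /=; rewrite mem_cat /C; case: ifP => xs /=; first by move=> _; exact: h1.
  exact: h2.
move=> h1; split => x /= xs.
  by have := h1 x; rewrite /= mem_cat xs /C xs; apply.
have := h1 x; rewrite /= mem_cat xs orbT /C ifF; first by apply.
by apply/negP => xs1; exact: (dis x).
Qed.

(** For fixed [A] both sides are finite measures in [B] that agree on the cylinders, a generating
    family stable under intersection. [indep_sigma] repeats the argument in the other variable. *)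
Lemma indep_cyl_sigma (I J : set int) (A B : set T) : I `&` J = set0 -> cyl I A ->
  measurable (B : set (FT J)) -> P (A `&` B) = (P A * P B)%E.
Proof.
move=> IJ cA mB.
have mA := cyl_measurable _ _ cA.
have PA0 : 0 <= fine (P A) by rewrite fine_ge0.
pose m2 := mscale (NngNum PA0) P.
suff h : mrestr P mA B = m2 B.
  by rewrite setIC [LHS]h /m2 /mscale /= fineK// fin_num_measure.
apply: (@g_sigma_algebra_measure_unique _ R T (cyl J)
  (fun B => @cyl_measurable J B) (fun=> setT)) => //.
- by move=> _; exact: cylT.
- by rewrite bigcup_const//; exists 0%N.
- exact: cyl_setI.
- move=> C cC; change (P (C `&` A) = ((fine (P A))%:E * P C)%E).
  rewrite fineK ?fin_num_measure// setIC.
  exact: (cyl_indep _ _ _ _ IJ cA cC).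
- by move=> _; change (P (setT `&` A) < +oo)%E; rewrite setTI (le_lt_trans (probability_le1 P mA)) ?ltry.
Qed.

Lemma indep_sigma (I J : set int) (A B : set T) : I `&` J = set0 ->
  measurable (A : set (FT I)) ->
  measurable (B : set (FT J)) -> P (A `&` B) = (P A * P B)%E.
Proof.
move=> IJ mA mB'.
have mB := sigma_on_measurable _ _ mB'.
have PB0 : 0 <= fine (P B) by rewrite fine_ge0.
pose m2 := mscale (NngNum PB0) P.
suff h : mrestr P mB A = m2 A.
  by rewrite [LHS]h /m2 /mscale /= fineK ?fin_num_measure// muleC.
apply: (@g_sigma_algebra_measure_unique _ R T (cyl I)
  (fun B => @cyl_measurable I B) (fun=> setT)) => //.
- by move=> _; exact: cylT.
- by rewrite bigcup_const//; exists 0%N.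
- exact: cyl_setI.
- move=> C cC; change (P (C `&` B) = ((fine (P B))%:E * P C)%E).
  rewrite fineK ?fin_num_measure// muleC.
  exact: (indep_cyl_sigma _ _ _ _ IJ cC mB').
- by move=> _; change (P (setT `&` B) < +oo)%E; rewrite setTI (le_lt_trans (probability_le1 P mB)) ?ltry.
Qed.

Definition to_sigma (I : set int) (t : T) : FT I := t.

Lemma measurable_to_sigma (I : set int) : measurable_fun setT (to_sigma I).
Proof. by move=> _ A mA; rewrite setTI; exact: (sigma_on_measurable _ _ mA). Qed.

HB.instance Definition _ I :=
  @isMeasurableFun.Build _ _ T (FT I) (to_sigma I) (measurable_to_sigma I).

(** Its law is the joint law of the two sigma-algebras; independence identifies it with the product
    of the marginals, after which Tonelli's theorem applies. *)
Definition diag (I J : set int) (t : T) : FT I * FT J := (t, t).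

Lemma measurable_diag I J : measurable_fun setT (diag I J).
Proof. by apply/measurable_fun_pairP; split; exact: measurable_to_sigma. Qed.

HB.instance Definition _ I J :=
  @isMeasurableFun.Build _ _ T (FT I * FT J)%type (diag I J) (measurable_diag I J).

Lemma ge0_integralM_indep (I J : set int) (f g : T -> \bar R) : I `&` J = set0 ->
  @measurable_fun _ _ (FT I) (\bar R) setT f -> @measurable_fun _ _ (FT J) (\bar R) setT g ->
  (forall t, 0 <= f t)%E -> (forall t, 0 <= g t)%E ->
  (\int[P]_t (f t * g t) = \int[P]_t f t * \int[P]_t g t)%E.
Proof.
move=> IJ mf mg f0 g0.
pose PI := distribution P (to_sigma I : {mfun T >-> FT I}).
pose PJ := distribution P (to_sigma J : {mfun T >-> FT J}).
pose PD := distribution P (diag I J : {mfun T >-> (FT I * FT J)%type}).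
pose h (z : FT I * FT J) := (f z.1 * g z.2)%E.
have mh : measurable_fun setT h.
  by apply: emeasurable_funM; [apply: (measurableT_comp mf)|apply: (measurableT_comp mg)].
have h0 z : (0 <= h z)%E by rewrite mule_ge0.
have -> : (\int[P]_t (f t * g t) = \int[PD]_z h z)%E by rewrite ge0_integral_distribution.
have -> : (\int[PD]_z h z = \int[PI \x PJ]_z h z)%E.
  apply: eq_measure_integral => A mA _; apply/esym.
  apply: product_measure_unique => // A1 B1 mA1 mB1.
  exact: (indep_sigma _ _ _ _ IJ mA1 mB1).
rewrite fubini_tonelli1// /fubini_F /h /=.
under eq_integral do rewrite ge0_integralZl//.
rewrite ge0_integralZr//; last exact: integral_ge0.
by rewrite /PI /PJ !ge0_integral_distribution.
Qed.
End independence.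

(** * Expectation of bounded functions of finitely many sites *)

Section calculus.
Context {d0 : measure_display} {T : measurableType d0} {R : realType}.
Context (P : probability T R) (w : int -> T -> R).
Hypothesis hiid : iid_family P w.

Local Notation FT := (sigma_on w).

(* Bounded, and depending measurably on the sites in [I] only. *)
Definition bmf (I : set int) (f : T -> R) : Prop :=
  @measurable_fun _ _ (FT I) R setT f /\ exists M, forall t, `|f t| <= M.

Definition mb (I : set int) (b : T -> bool) : Prop :=
  @measurable_fun _ _ (FT I) bool setT b.

Definition Ex (f : T -> R) : R := Rintegral P setT f.

Lemma bmf_mono (I J : set int) f : I `<=` J -> bmf I f -> bmf J f.
Proof.
move=> IJ [mf bf]; split => // _ A mA.
by apply: (sigma_on_mono w I J) => //; exact: mf.
Qed.

Lemma mb_mono (I J : set int) b : I `<=` J -> mb I b -> mb J b.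
Proof.
move=> IJ mb _ A mA.
by apply: (sigma_on_mono w I J) => //; exact: mb.
Qed.

Lemma bmf_cst I r : bmf I (fun=> r).
Proof. by split; [exact: measurable_cst|exists `|r|]. Qed.

Lemma bmfD I f g : bmf I f -> bmf I g -> bmf I (fun t => f t + g t).
Proof.
move=> [mf [Mf hf]] [mg [Mg hg]]; split; first exact: measurable_funD.
by exists (Mf + Mg) => t; rewrite (le_trans (ler_normD _ _))// lerD.
Qed.

Lemma bmfM I f g : bmf I f -> bmf I g -> bmf I (fun t => f t * g t).
Proof.
move=> [mf [Mf hf]] [mg [Mg hg]]; split; first exact: measurable_funM.
by exists (Mf * Mg) => t; rewrite normrM ler_pM.
Qed.

Lemma bmfN I f : bmf I f -> bmf I (fun t => - f t).
Proof.
move=> hf; rewrite (_ : (fun t => _) = fun t => (-1) * f t); last first.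
  by apply/funext => t; rewrite mulN1r.
by apply: bmfM => //; exact: bmf_cst.
Qed.

Lemma bmfB I f g : bmf I f -> bmf I g -> bmf I (fun t => f t - g t).
Proof. by move=> hf hg; apply: bmfD => //; exact: bmfN. Qed.

Lemma bmf_sum I (J : Type) (s : seq J) (F : J -> T -> R) :
  (forall j, bmf I (F j)) -> bmf I (fun t => \sum_(j <- s) F j t).
Proof.
move=> hF; elim: s => [|j s IH].
  by under eq_fun do rewrite big_nil; exact: bmf_cst.
by under eq_fun do rewrite big_cons; exact: bmfD.
Qed.

Lemma bmf_prod I (J : Type) (s : seq J) (F : J -> T -> R) :
  (forall j, bmf I (F j)) -> bmf I (fun t => \prod_(j <- s) F j t).
Proof.
move=> hF; elim: s => [|j s IH].
  by under eq_fun do rewrite big_nil; exact: bmf_cst.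
by under eq_fun do rewrite big_cons; exact: bmfM.
Qed.

Lemma bmf_site (h : R -> R) x : measurable_fun setT h ->
  (exists M, forall t, `|h (w x t)| <= M) -> bmf [set x] (fun t => h (w x t)).
Proof.
move=> mh bh; split => //.
have mx : @measurable_fun _ _ (FT [set x]) R setT (w x).
  move=> _ A mA; rewrite setTI; apply: sub_sigma_algebra.
  exists [:: x], (fun=> A); split => //; first by move=> y; rewrite inE => /eqP.
  apply/seteqP; split => t /=; first by move=> At y /=; rewrite inE => /eqP ->.
  by apply; rewrite /= mem_head.
exact: (measurableT_comp mh mx).
Qed.

Lemma mb_le I f g : bmf I f -> bmf I g -> mb I (fun t => f t <= g t).
Proof. by move=> [mf _] [mg _]; exact: measurable_fun_ler. Qed.

Lemma mb_lt I f g : bmf I f -> bmf I g -> mb I (fun t => f t < g t).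
Proof. by move=> [mf _] [mg _]; exact: measurable_fun_ltr. Qed.

Lemma mb_and I b c : mb I b -> mb I c -> mb I (fun t => b t && c t).
Proof. exact: measurable_and. Qed.

Lemma mb_or I b c : mb I b -> mb I c -> mb I (fun t => b t || c t).
Proof. exact: measurable_or. Qed.

Lemma mb_neg I b : mb I b -> mb I (fun t => ~~ b t).
Proof. exact: measurable_neg. Qed.

Lemma mb_has I (J : Type) (s : seq J) (b : J -> T -> bool) :
  (forall j, mb I (b j)) -> mb I (fun t => has (b^~ t) s).
Proof.
move=> hb; elim: s => [|j s IH] /=; first exact: measurable_cst.
exact: mb_or.
Qed.

Lemma bmf_ind I b : mb I b -> bmf I (fun t => (b t)%:R).
Proof.
move=> mb; split; last by exists 1 => t; case: (b t); rewrite ?normr1 ?normr0.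
rewrite (_ : (fun t => _) = fun t => if b t then 1 else 0).
  by apply: measurable_fun_ifT => //; exact: measurable_cst.
by apply/funext => t; case: (b t).
Qed.

Lemma bmf_measurable I f : bmf I f -> measurable_fun setT f.
Proof.
move=> [mf _] _ A mA; apply: (sigma_on_measurable P w hiid I).
by apply: mf.
Qed.

Lemma bmf_integrable I f : bmf I f -> P.-integrable setT (EFin \o f).
Proof.
move=> hf; apply: measurable_bounded_integrable => //.
- by rewrite (le_lt_trans (probability_le1 P measurableT))// ltry.
- exact: (bmf_measurable I).
- case: hf => _ [M hM]; exists M; split; first by rewrite num_real.
  by move=> x Mx t _ /=; rewrite (le_trans (hM t))// ltW.
Qed.

Lemma Ex_cst r : Ex (fun=> r) = r.
Proof. by rewrite /Ex Rintegral_cst// [X in fine X](probability_setT P) mulr1. Qed.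

Lemma ExD I f g : bmf I f -> bmf I g -> Ex (fun t => f t + g t) = Ex f + Ex g.
Proof. by move=> hf hg; rewrite /Ex RintegralD//; exact: (bmf_integrable I). Qed.

Lemma ExB I f g : bmf I f -> bmf I g -> Ex (fun t => f t - g t) = Ex f - Ex g.
Proof. by move=> hf hg; rewrite /Ex RintegralB//; exact: (bmf_integrable I). Qed.

Lemma ExZ I r f : bmf I f -> Ex (fun t => r * f t) = r * Ex f.
Proof. by move=> hf; rewrite /Ex RintegralZl//; exact: (bmf_integrable I). Qed.

Lemma Ex_le I f g : bmf I f -> bmf I g -> (forall t, f t <= g t) -> Ex f <= Ex g.
Proof.
by move=> hf hg fg; apply: le_Rintegral => //; exact: (bmf_integrable I).
Qed.

Lemma Ex_ge0 f : (forall t, 0 <= f t) -> 0 <= Ex f.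
Proof. by move=> f0; apply: Rintegral_ge0. Qed.

Lemma eq_Ex f g : f =1 g -> Ex f = Ex g.
Proof. by move=> fg; congr Ex; exact/funext. Qed.

Lemma Ex_sum I (J : Type) (s : seq J) (F : J -> T -> R) :
  (forall j, bmf I (F j)) -> Ex (fun t => \sum_(j <- s) F j t) = \sum_(j <- s) Ex (F j).
Proof.
move=> hF; elim: s => [|j s IH].
  by under eq_Ex do rewrite big_nil; rewrite Ex_cst big_nil.
under eq_Ex do rewrite big_cons.
by rewrite (ExD I) ?IH ?big_cons//; exact: bmf_sum.
Qed.

Lemma EFin_Ex I f : bmf I f -> (Ex f)%:E = (\int[P]_t (f t)%:E)%E.
Proof.
move=> hf; rewrite /Ex /Rintegral fineK//.
exact: integrable_fin_num (bmf_integrable I f hf).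
Qed.

Lemma Ex_prob I b : mb I b -> (Ex (fun t => (b t)%:R))%:E = P [set t | b t].
Proof.
move=> hb; rewrite (EFin_Ex I); last exact: bmf_ind.
have mb : measurable [set t | b t].
  apply: (sigma_on_measurable P w hiid I).
  by have := hb measurableT [set true]; rewrite setTI; apply.
rewrite -[X in _ = P X](setIT [set t | b t]) -integral_indic//.
apply: eq_integral => t _; congr EFin; rewrite /indic.
by case: (boolP (b t)) => bt; [rewrite mem_set|rewrite memNset//= (negbTE bt)].
Qed.

Lemma ExM_indep_ge0 (I J : set int) f g : I `&` J = set0 -> bmf I f -> bmf J g ->
  (forall t, 0 <= f t) -> (forall t, 0 <= g t) ->
  Ex (fun t => f t * g t) = Ex f * Ex g.
Proof.
move=> IJ hf hg f0 g0; apply: EFin_inj.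
rewrite EFinM (EFin_Ex I f)// (EFin_Ex J g)// (EFin_Ex (I `|` J)); last first.
  by apply: bmfM; [apply: bmf_mono hf|apply: bmf_mono hg] => x; [left|right].
under eq_integral do rewrite EFinM.
apply: (ge0_integralM_indep P w hiid I J) => //.
- by apply/measurable_EFinP; case: hf.
- by apply/measurable_EFinP; case: hg.
Qed.

Lemma Ex_site (h : R -> R) x : measurable_fun setT h -> (forall v, 0 <= h v) ->
  Ex (fun t => h (w x t)) = Ex (fun t => h (w 0 t)).
Proof.
move=> mh h0; congr fine.
pose W y : {mfun T >-> R} :=
  HB.pack (w y) (isMeasurableFun.Build _ _ T R (w y) (measurable_site P w hiid y)).
have push y : (\int[P]_t (h (w y t))%:E = \int[distribution P (W y)]_v (h v)%:E)%E.
  by rewrite ge0_integral_distribution//; exact/measurable_EFinP.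
rewrite !push; apply: eq_measure_integral => A mA _.
have [_ [_ h1]] := hiid; exact: h1.
Qed.
End calculus.

(** * Valleys of the potential *)

Definition sites (b : int) (i : nat) : set int := [set x | b < x <= b + i%:Z].

Lemma sites_le b i j : (i <= j)%N -> sites b i `<=` sites b j.
Proof. by move=> ij x; rewrite /sites /=; lia. Qed.

Lemma sites_pred b i : sites b i.-1 `<=` sites b i.
Proof. by apply: sites_le; exact: leq_pred. Qed.

Lemma sites_tail a j i l : (j + i <= l)%N -> sites (a + j%:Z) i `<=` sites a l.
Proof. by move=> jl x; rewrite /sites /=; lia. Qed.

Lemma sites_tail_le a l (j : 'I_l) i : (i <= l - j)%N -> sites (a + j%:Z) i `<=` sites a l.
Proof. by move=> il; apply: sites_tail; have := ltn_ord j; lia. Qed.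

Lemma sites_disjoint b i N : sites b i `&` sites (b + i%:Z) N = set0.
Proof. by apply/seteqP; split => // x []; rewrite /sites /=; lia. Qed.

Lemma sum_subn_ord (V : nmodType) (F : nat -> V) l :
  \sum_(j < l) F (l - j)%N = \sum_(i < l) F i.+1.
Proof.
rewrite (reindex_inj rev_ord_inj) /=; apply: eq_bigr => i _.
by rewrite subKn.
Qed.

Lemma union_bound4 (V : realFieldType) (b1 b2 b3 b4 : bool) :
  1 - (~~ b1)%:R - (~~ b2)%:R - (~~ b3)%:R - (~~ b4)%:R <= ([&& b1, b2, b3 & b4])%:R :> V.
Proof. by case: b1; case: b2; case: b3; case: b4 => /=; lra. Qed.

Lemma expr_small (V : realType) (m e : V) : 0 <= m < 1 -> 0 < e -> exists n, m ^+ n <= e.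
Proof.
move=> m01 e0.
have /cvgrPdist_lt /(_ e e0) [k _ Hk] : (fun n => m ^+ n) @ \oo --> (0 : V).
  by apply: cvg_expr; rewrite ger0_norm; lra.
exists k; have := Hk k (leqnn _); rewrite sub0r normrN ger0_norm; first by lra.
by rewrite exprn_ge0//; lra.
Qed.

Lemma sum_exp_gap (V : realFieldType) (m : V) j : 0 <= m <= 2^-1 ->
  \sum_(i < j) m ^+ (j - i) <= 2 * m.
Proof.
move=> m01; rewrite (sum_subn_ord V (fun i => m ^+ i)).
suff : \sum_(i < j) m ^+ i.+1 <= 2 * m - 2 * (m ^+ j * m).
  have : 0 <= m ^+ j * m by rewrite mulr_ge0 ?exprn_ge0//; lra.
  lra.
elim: j => [|j IH]; first by rewrite big_ord0 expr0; lra.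
rewrite big_ord_recr /= exprSr.
have : m ^+ j * m * m <= m ^+ j * m * 2^-1.
  by rewrite ler_wpM2l ?mulr_ge0 ?exprn_ge0//; lra.
lra.
Qed.

(** The pairs are counted with the weaker events [c]. In the application [b] also demands a good
    approach, which may overlap the other valley, while [c] keeps only the valley. *)
Lemma bonferroni (V : realFieldType) (b c : nat -> bool) m : (forall i, b i -> c i) ->
  \sum_(i < m) (b i)%:R - \sum_(j < m) \sum_(i < j) (c i && c j)%:R <=
  (has b (iota 0 m))%:R :> V.
Proof.
move=> bc; elim: m => [|m IH]; first by rewrite !big_ord0 subr0.
rewrite -[m.+1 in leRHS]addn1 iotaD has_cat !big_ord_recr /= add0n orbF.
have s0 : 0 <= \sum_(i < m) (c i && c m)%:R :> V by apply: sumr_ge0.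
have T1 : true%:R = 1 :> V by [].
have F0 : false%:R = 0 :> V by [].
case: (boolP (b m)) => bm; rewrite ?orbF ?orbT ?T1 ?F0; last by move: IH s0; lra.
have [/hasP[i im bi]|/negbTE nh] := boolP (has b (iota 0 m)); last first.
  by move: IH s0; rewrite nh F0; lra.
have : 1 <= \sum_(i < m) (c i && c m)%:R :> V.
  move: im; rewrite mem_iota => /andP[_ im].
  by rewrite (bigD1 (Ordinal im))//= !bc//= lerDl sumr_ge0.
have : (has b (iota 0 m))%:R <= 1 :> V by rewrite lern1 leq_b1.
by move: IH; lra.
Qed.

(* [hV = h ^- 2] is, up to a constant, the probability that a given site is the bottom of a
   valley of height [h], and [u] the expected number of such sites among [m] candidates. *)
Lemma approach_budget (V : realFieldType) (l g s m : nat) (hV K0 u al : V) :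
  (l <= g + s * m)%N -> 0 <= hV -> 0 <= K0 -> u = m%:R * hV -> u <= al ->
  16 * g%:R * hV * K0 <= 1 -> 16 * s%:R * al * K0 <= 1 -> l%:R * hV * K0 <= 8^-1.
Proof.
move=> lg h0 K00 -> ual hg hs.
have l1 : l%:R <= g%:R + s%:R * m%:R :> V by rewrite -natrM -natrD ler_nat.
have hK : 0 <= hV * K0 by rewrite mulr_ge0.
have a1 := ler_wpM2r hK l1.
have s0 : 0 <= s%:R * K0 by rewrite mulr_ge0.
have a2 := ler_wpM2l s0 ual.
move: (l%:R) (g%:R) (s%:R) (m%:R) a1 a2 hg hs => L G S M a1 a2 hg hs; lra.
Qed.

Lemma block_budget (V : realFieldType) (u al B D : V) :
  0 < B -> al <= B / 32 -> D <= B / 32 -> al / 2 <= u <= al -> 0 < al ->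
  al * B / 16 <= u * (B / 4) - u * u - u * D.
Proof. move=> *; nra. Qed.

Lemma four_eighths (V : realFieldType) (a b c : V) : a <= 8^-1 -> b <= 8^-1 -> c <= 8^-1 ->
  2^-1 <= 1 - a - b - c - b.
Proof. by move=> *; lra. Qed.

Lemma trunc_half (V : realFieldType) (a u v : V) : 2 <= a * u -> a * u < v + 1 ->
  a / 2 * u <= v.
Proof. by move=> *; lra. Qed.

(* To be used with [y = rho ^ (kappa / 2)] and [q = 2 / kappa]: then [y ^ q = rho], and the
   moments of [y] of orders 1, 2 and [q] are [mu < 1], [1] and [nu > 1].  With [V] the
   potential, [xprod b i = exp (V (b + i) - V b)] and [yprod b i] is its power [kappa / 2]. *)
Section environment.
Context {d0 : measure_display} {T : measurableType d0} {R : realType}.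
Context (P : probability T R) (w : int -> T -> R).
Hypothesis hiid : iid_family P w.
Variables (y : int -> T -> R) (be q mu nu : R).
Hypothesis be_gt1 : 1 < be.
Hypothesis y_gt0 : forall x t, 0 < y x t.
Hypothesis y_le : forall x t, y x t <= be.
Hypothesis q_gt2 : 2 < q.
Hypothesis bmf_y : forall x, bmf w [set x] (y x).
Hypothesis bmf_yV : forall x, bmf w [set x] (fun t => (y x t)^-1).
Hypothesis bmf_yq : forall x, bmf w [set x] (fun t => y x t `^ q).
Hypothesis mu01 : 0 < mu < 1.
Hypothesis nu_gt1 : 1 < nu.
Hypothesis Ey : forall x, Ex P (y x) = mu.
Hypothesis Ey2 : forall x, Ex P (fun t => y x t * y x t) = 1.
Hypothesis Eyq : forall x, Ex P (fun t => y x t `^ q) = nu.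

Local Notation Ex := (Ex P).
Local Notation bmf := (bmf w).
Local Notation mb := (mb w).

Definition yprod (b : int) (i : nat) (t : T) : R := \prod_(k < i) y (b + k.+1%:Z) t.

Definition xprod (b : int) (i : nat) (t : T) : R := yprod b i t `^ q.

Lemma yprod0 b t : yprod b 0 t = 1. Proof. by rewrite /yprod big_ord0. Qed.

Lemma yprodS b i t : yprod b i.+1 t = yprod b i t * y (b + i.+1%:Z) t.
Proof. by rewrite /yprod big_ord_recr. Qed.

Lemma yprod_gt0 b i t : 0 < yprod b i t.
Proof. by apply: prodr_gt0. Qed.

Lemma xprod0 b t : xprod b 0 t = 1. Proof. by rewrite /xprod yprod0 powR1. Qed.

Lemma xprodS b i t : xprod b i.+1 t = xprod b i t * y (b + i.+1%:Z) t `^ q.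
Proof. by rewrite /xprod yprodS powRM// ltW// yprod_gt0. Qed.

Lemma xprod_gt0 b i t : 0 < xprod b i t.
Proof. by rewrite powR_gt0 ?yprod_gt0. Qed.

Lemma bmf_site_sub x f (J : set int) : bmf [set x] f -> J x -> bmf J f.
Proof. by move=> hf Jx; apply: (bmf_mono w [set x]) => // z /= ->. Qed.

Lemma bmf_yprod b i (J : set int) : sites b i `<=` J -> bmf J (yprod b i).
Proof.
move=> hJ; apply: bmf_prod => k; apply: (bmf_site_sub (b + k.+1%:Z)) => //.
by apply: hJ; rewrite /sites /=; have := ltn_ord k; lia.
Qed.

Lemma bmf_xprod b i (J : set int) : sites b i `<=` J -> bmf J (xprod b i).
Proof.
elim: i => [|i IH] hJ.
  by rewrite (_ : xprod b 0 = fun=> 1); [exact: bmf_cst|apply/funext => t; exact: xprod0].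
rewrite (_ : xprod b i.+1 = fun t => xprod b i t * y (b + i.+1%:Z) t `^ q); last first.
  by apply/funext => t; exact: xprodS.
apply: bmfM; first by apply: IH; apply: subset_trans hJ; exact: sites_le.
by apply: (bmf_site_sub (b + i.+1%:Z)) => //; apply: hJ; rewrite /sites /=; lia.
Qed.

Lemma bmf_yprodV b i (J : set int) : sites b i `<=` J -> bmf J (fun t => (yprod b i t)^-1).
Proof.
move=> hJ; rewrite (_ : (fun t => _) = fun t => \prod_(k < i) (y (b + k.+1%:Z) t)^-1).
  apply: bmf_prod => k; apply: (bmf_site_sub (b + k.+1%:Z)) => //.
  by apply: hJ; rewrite /sites /=; have := ltn_ord k; lia.
by apply/funext => t; rewrite prodfV.
Qed.

Lemma Ex_next b i f g : bmf (sites b i) f -> bmf [set b + i.+1%:Z] g ->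
  (forall t, 0 <= f t) -> (forall t, 0 <= g t) ->
  Ex (fun t => f t * g t) = Ex f * Ex g.
Proof.
move=> hf hg f0 g0; apply: (ExM_indep_ge0 P w hiid (sites b i) [set b + i.+1%:Z]) => //.
by apply/seteqP; split => // x [] /=; rewrite /sites /=; lia.
Qed.

Lemma Ex_yprod b i : Ex (yprod b i) = mu ^+ i.
Proof.
elim: i => [|i IH].
  rewrite expr0 -[RHS](Ex_cst P); apply: eq_Ex => t; exact: yprod0.
rewrite exprSr -IH -(Ey (b + i.+1%:Z)) -(Ex_next b i).
- by apply: eq_Ex => t; rewrite yprodS.
- exact: bmf_yprod.
- exact: bmf_y.
- by move=> t; rewrite ltW// yprod_gt0.
- by move=> t; rewrite ltW.
Qed.

(** * First passage of the potential above a level *)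

Definition below (h : R) (b : int) (i : nat) (t : T) : bool :=
  all (fun k => yprod b k t < h) (iota 0 i).

Definition exceed (h : R) (b : int) (i : nat) (t : T) : bool :=
  below h b i t && (h <= yprod b i t).

Lemma belowS h b i t : below h b i.+1 t = below h b i t && (yprod b i t < h).
Proof. by rewrite /below -addn1 iotaD all_cat /= add0n andbT. Qed.

Lemma below_le h b i j t : (i <= j)%N -> below h b j t -> below h b i t.
Proof.
move=> ij /allP H; apply/allP => k; rewrite mem_iota => /andP[_ ki].
by apply: H; rewrite mem_iota; lia.
Qed.

Lemma exceed_below h b i j t : exceed h b i t -> (i < j)%N -> ~~ below h b j t.
Proof.
move=> /andP[_ hY] ij; apply/negP => /allP /(_ i).
by rewrite mem_iota /= => /(_ ij); rewrite ltNge hY.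
Qed.

(** The predecessor comes from [below h b i] not looking at [yprod b i]; thus [below h b i.+1] is
    still independent of the site [b + i.+1]. *)
Lemma mb_below h b i (J : set int) : sites b i.-1 `<=` J -> mb J (below h b i).
Proof.
elim: i => [|i IH] hJ; first by exact: measurable_cst.
rewrite (_ : below h b i.+1 = fun t => below h b i t && (yprod b i t < h)); last first.
  by apply/funext => t; exact: belowS.
apply: mb_and; last by apply: mb_lt; [exact: bmf_yprod|exact: bmf_cst].
by apply: IH; apply: subset_trans hJ; exact: sites_pred.
Qed.

Lemma mb_exceed h b i (J : set int) : sites b i `<=` J -> mb J (exceed h b i).
Proof.
move=> hJ; apply: mb_and; last by apply: mb_le; [exact: bmf_cst|exact: bmf_yprod].
by apply: mb_below; apply: subset_trans hJ; exact: sites_pred.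
Qed.

Lemma split_below h b i t :
  (below h b i t)%:R = (exceed h b i t)%:R + (below h b i.+1 t)%:R :> R.
Proof.
rewrite /exceed belowS; case: (below h b i t) => /=; last by rewrite addr0.
by case: ltP; rewrite ?add0r ?addr0.
Qed.

Lemma sum_exceed h b n t : \sum_(i < n) (exceed h b i t)%:R = (~~ below h b n t)%:R :> R.
Proof.
elim: n => [|n IH]; first by rewrite big_ord0.
rewrite big_ord_recr /= IH /exceed belowS.
by case: (below h b n t) => /=; rewrite ?addr0// add0r -leNgt.
Qed.

(** At first passage the overshoot is at most one factor [y <= be]. *)
Lemma exceed_yprod_le h b i t : 1 <= h -> below h b i t -> yprod b i t <= be * h.
Proof.
move=> h1; case: i => [_|i]; first by rewrite yprod0; have := be_gt1; nra.
rewrite belowS => /andP[_ Yh]; rewrite yprodS mulrC.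
have := y_le (b + i.+1%:Z) t; have := y_gt0 (b + i.+1%:Z) t; have := yprod_gt0 b i t.
by have := be_gt1; nra.
Qed.

(* [yprod ^+ 2] is a martingale; [Z] is a weight depending only on the first [j] sites. *)
Lemma Ex_stopped h b Z j n : bmf (sites b j) Z -> (forall t, 0 <= Z t) -> (j <= n)%N ->
  Ex (fun t => Z t * yprod b n t ^+ 2 * (below h b n t)%:R) +
  \sum_(j <= i < n) Ex (fun t => Z t * yprod b i t ^+ 2 * (exceed h b i t)%:R) =
  Ex (fun t => Z t * yprod b j t ^+ 2 * (below h b j t)%:R).
Proof.
move=> hZ Z0 /subnK <-; elim: (n - j)%N => [|m IH].
  by rewrite add0n big_geq// addr0.
rewrite -IH addSn big_nat_recr /=; last by lia.
set i := (m + j)%N; rewrite addrCA addrC; congr (_ + _).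
have sub k : (k <= i)%N -> sites b k `<=` sites b i.
  exact: sites_le.
have hZi : bmf (sites b i) Z by apply: bmf_mono hZ; apply: sub; lia.
have hY2 : bmf (sites b i) (fun t => yprod b i t ^+ 2).
  by rewrite /GRing.exp /=; apply: bmfM; exact: bmf_yprod.
(* The next site is independent of all the other factors, and y^2 has mean one there. *)
have e1 : Ex (fun t => Z t * yprod b i.+1 t ^+ 2 * (below h b i.+1 t)%:R) =
   Ex (fun t => Z t * yprod b i t ^+ 2 * (below h b i.+1 t)%:R).
  rewrite -[RHS]mulr1 -[X in _ = _ * X](Ey2 (b + i.+1%:Z)) -(Ex_next b i).
  - by apply: eq_Ex => t; rewrite yprodS; ring.
  - apply: bmfM; first exact: bmfM.
    by apply: bmf_ind; apply: mb_below.
  - by apply: bmfM; exact: bmf_y.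
  - by move=> t; apply: mulr_ge0 => //; apply: mulr_ge0 => //; exact: sqr_ge0.
  - by move=> t; rewrite mulr_ge0// ltW.
rewrite e1 addrC -(ExD P w hiid (sites b i)).
- by apply: eq_Ex => t; rewrite [in RHS]split_below mulrDr.
- apply: bmfM; first exact: bmfM.
  by apply: bmf_ind; apply: mb_exceed.
- apply: bmfM; first exact: bmfM.
  by apply: bmf_ind; apply: mb_below.
Qed.

Lemma Ex_stopped1 h b n :
  Ex (fun t => yprod b n t ^+ 2 * (below h b n t)%:R) +
  \sum_(i < n) Ex (fun t => yprod b i t ^+ 2 * (exceed h b i t)%:R) = 1.
Proof.
have := Ex_stopped h b (fun=> 1) 0 n (bmf_cst w _ 1) (fun=> ler01) (leq0n _).
rewrite big_mkord => H.
rewrite -[RHS](Ex_cst P); transitivity (Ex (fun t => 1 * yprod b 0 t ^+ 2 * (below h b 0 t)%:R)).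
  rewrite -H; congr (_ + _); first by apply: eq_Ex => t; rewrite mul1r.
  by apply: eq_bigr => i _; apply: eq_Ex => t; rewrite mul1r.
by apply: eq_Ex => t; rewrite yprod0 expr1n !mulr1.
Qed.

Lemma bmf_yprod_exceed h b i (J : set int) : sites b i `<=` J ->
  bmf J (fun t => yprod b i t ^+ 2 * (exceed h b i t)%:R).
Proof.
move=> hJ; apply: bmfM; last by apply: bmf_ind; exact: mb_exceed.
by rewrite /GRing.exp /=; apply: bmfM; exact: bmf_yprod.
Qed.

(** Doob's maximal inequality: the first-passage events are disjoint, the martingale is at least h^2
    on each of them, and its total weight is 1. *)
Lemma Ex_exceeds h b n : 0 < h -> Ex (fun t => (~~ below h b n t)%:R) <= h ^- 2.
Proof.
move=> h0.
have subn i : (i < n)%N -> sites b i `<=` sites b n.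
  by move=> iN; apply: sites_le; exact: ltnW.
have bme i : bmf (sites b n) (fun t => (exceed h b (i : 'I_n) t)%:R).
  by apply: bmf_ind; apply: mb_exceed; exact: subn.
under eq_Ex do rewrite -sum_exceed.
rewrite (Ex_sum P w hiid (sites b n))//.
rewrite -[leRHS]mul1r ler_pdivlMr ?exprn_gt0// -[leRHS](Ex_stopped1 h b n) mulr_suml.
apply: ler_wpDl.
  by apply: Ex_ge0 => t; rewrite mulr_ge0 ?sqr_ge0.
apply: ler_sum => i _; rewrite mulrC -(ExZ P w hiid (sites b n))//.
apply: (Ex_le P w hiid (sites b n)).
- by apply: bmfM => //; exact: bmf_cst.
- by apply: bmf_yprod_exceed; exact: subn.
- move=> t; case: (boolP (exceed h b i t)) => [/andP[_ hY]|]; rewrite ?mulr0 ?mulr1//.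
  by rewrite lerXn2r// nnegrE ltW// yprod_gt0.
Qed.

Lemma powR_split (v : R) : 0 < v -> v `^ q = v ^+ 2 * v `^ (q - 2).
Proof.
move=> v0; rewrite -powR_mulrn ?ltW// -powRD; first by rewrite addrC subrK.
by apply/implyP => _; rewrite lt0r_neq0.
Qed.

Lemma xprod_le h b i t : 1 <= h -> below h b i t ->
  xprod b i t <= (be * h) `^ (q - 2) * yprod b i t ^+ 2.
Proof.
move=> h1 bt; rewrite /xprod powR_split ?yprod_gt0// mulrC ler_wpM2r ?sqr_ge0//.
have Yle := exceed_yprod_le h b i t h1 bt.
by apply: ge0_ler_powR => //; rewrite ?nnegrE ?(le_trans _ Yle)// ?ltW ?yprod_gt0//; have := q_gt2; lra.
Qed.

(** With the truncation just after or just before index i, the means [a i] and [c i] satisfy nu a_i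
    = c_(i+1) and c_i = f_i + a_i, [f i] being the part at first passage. Summing telescopes to (nu
    - 1) sum a = c_n - c_0 + sum f. By [xprod_le] the right side is at most (be h)^(q-2) times a
    martingale total equal to 1. *)
Lemma Ex_truncated_sum h b n : 1 <= h ->
  \sum_(i < n) Ex (fun t => xprod b i t * (below h b i.+1 t)%:R) <=
  (be * h) `^ (q - 2) / (nu - 1).
Proof.
move=> h1.
pose a i := Ex (fun t => xprod b i t * (below h b i.+1 t)%:R).
pose c i := Ex (fun t => xprod b i t * (below h b i t)%:R).
pose f i := Ex (fun t => xprod b i t * (exceed h b i t)%:R).
have mX i : bmf (sites b i) (xprod b i) by exact: bmf_xprod.
have mbS i : bmf (sites b i) (fun t => (below h b i.+1 t)%:R).
  by apply: bmf_ind; apply: mb_below.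
have mb0 i : bmf (sites b i) (fun t => (below h b i t)%:R).
  by apply: bmf_ind; apply: mb_below; exact: sites_pred.
have me i : bmf (sites b i) (fun t => (exceed h b i t)%:R).
  by apply: bmf_ind; apply: mb_exceed.
have cE i : c i = f i + a i.
  rewrite -(ExD P w hiid (sites b i)); [|exact: bmfM..].
  by apply: eq_Ex => t; rewrite split_below mulrDr.
have aE i : nu * a i = c i.+1.
  rewrite -(Eyq (b + i.+1%:Z)) mulrC -(Ex_next b i).
  - by apply: eq_Ex => t; rewrite xprodS mulrAC.
  - exact: bmfM.
  - exact: bmf_yq.
  - by move=> t; rewrite mulr_ge0// ltW// xprod_gt0.
  - by move=> t; rewrite powR_ge0.
have tele : (nu - 1) * \sum_(i < n) a i = c n - c 0%N + \sum_(i < n) f i.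
  elim: (n) => [|m IH]; first by rewrite !big_ord0 subrr mulr0 addr0.
  by rewrite !big_ord_recr /= mulrDr IH mulrBl aE mul1r (cE m); ring.
have nu1 : 0 < nu - 1 by have := nu_gt1; lra.
rewrite ler_pdivlMr// mulrC tele.
have c0 : 0 <= c 0%N by apply: Ex_ge0 => t; rewrite mulr_ge0// ltW// xprod_gt0.
rewrite -[leRHS]mulr1 -[X in _ * X](Ex_stopped1 h b n) mulrDr.
have Y2 i : bmf (sites b i) (fun t => yprod b i t ^+ 2).
  by rewrite /GRing.exp /=; apply: bmfM; exact: bmf_yprod.
have h1' : c n <= (be * h) `^ (q - 2) * Ex (fun t => yprod b n t ^+ 2 * (below h b n t)%:R).
  rewrite -(ExZ P w hiid (sites b n)); last exact: bmfM.
  apply: (Ex_le P w hiid (sites b n)); first exact: bmfM.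
    by apply: bmfM; [exact: bmf_cst|exact: bmfM].
  move=> t; case: (boolP (below h b n t)) => bt; rewrite ?mulr0 ?mulr1//.
  exact: xprod_le.
have h2' : \sum_(i < n) f i <= (be * h) `^ (q - 2) *
    \sum_(i < n) Ex (fun t => yprod b i t ^+ 2 * (exceed h b i t)%:R).
  rewrite mulr_sumr; apply: ler_sum => i _.
  rewrite -(ExZ P w hiid (sites b i)); last exact: bmfM.
  apply: (Ex_le P w hiid (sites b i)); first exact: bmfM.
    by apply: bmfM; [exact: bmf_cst|exact: bmfM].
  move=> t; case: (boolP (exceed h b i t)) => [/andP[bt _]|]; rewrite ?mulr0 ?mulr1//.
  exact: xprod_le.
lra.
Qed.

Lemma geom_le n : \sum_(i < n) mu ^+ i <= (1 - mu)^-1.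
Proof.
have m0 : 0 < 1 - mu by have := mu01; lra.
rewrite -[leRHS]mul1r ler_pdivlMr// mulrC.
have -> : (1 - mu) * \sum_(i < n) mu ^+ i = 1 - mu ^+ n.
  elim: n => [|n IH]; first by rewrite big_ord0 mulr0 expr0 subrr.
  by rewrite big_ord_recr /= mulrDr IH exprS; ring.
by rewrite lerBlDr lerDl exprn_ge0//; have := mu01; lra.
Qed.

Lemma markov_Ex I f (c : R) : bmf I f -> 0 < c -> (forall t, 0 <= f t) ->
  Ex (fun t => (c < f t)%R%:R) <= c^-1 * Ex f.
Proof.
move=> hf c0 f0; rewrite -(ExZ P w hiid I)//.
apply: (Ex_le P w hiid I).
- by apply: bmf_ind; apply: mb_lt => //; exact: bmf_cst.
- by apply: bmfM => //; exact: bmf_cst.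
- move=> t; case: ltP => [cf|_] /=; last by rewrite mulr_ge0// invr_ge0 ltW.
  by rewrite mulrC ler_pdivlMr// mul1r ltW.
Qed.

(** * Valleys: their probability and their decorrelation *)

Definition shallow (C : R) (b : int) (r : nat) (t : T) : bool :=
  \sum_(i < r.+1) (yprod b i t)^-1 <= C.

(** The potential climbs from the bottom [b] to height [h] before index [N], while the sites on the
    way carry little reversible mass relative to [b]. The horizon makes this an event of finitely
    many sites. *)
Definition valley (h C : R) (N : nat) (b : int) (t : T) : bool :=
  has (fun r => exceed h b r t && shallow C b r t) (iota 0 N).

Lemma valleyS h C N b t : valley h C N.+1 b t = valley h C N b t ||
  (exceed h b N t && shallow C b N t).
Proof. by rewrite /valley -addn1 iotaD has_cat /= add0n orbF. Qed.

Lemma valley_exceeds h C N b t : valley h C N b t -> ~~ below h b N t.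
Proof.
move=> /hasP[r]; rewrite mem_iota => /andP[_ rN] /andP[er _].
exact: exceed_below er rN.
Qed.

Lemma sum_valley h C N b t :
  \sum_(r < N) (exceed h b r t && shallow C b r t)%:R <=
  (valley h C N b t)%:R :> R.
Proof.
elim: N => [|N IH]; first by rewrite big_ord0.
rewrite big_ord_recr /= valleyS; case: (boolP (exceed h b N t)) => e /=; last first.
  by rewrite addr0 orbF.
case: (boolP (valley h C N b t)) IH => [v|v] /= IH.
  by have := valley_exceeds _ _ _ _ _ v; case/andP: e => ->.
by apply: le_trans (lerD IH (lexx _)) _; rewrite add0r.
Qed.

Lemma mb_shallow C b r (J : set int) : sites b r `<=` J ->
  mb J (shallow C b r).
Proof.
move=> hJ; apply: mb_le; last exact: bmf_cst.
by apply: bmf_sum => i; apply: bmf_yprodV; apply: subset_trans hJ; apply: sites_le; rewrite -ltnS.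
Qed.

Lemma mb_valley h C N b (J : set int) : sites b N `<=` J -> mb J (valley h C N b).
Proof.
elim: N => [|N IH] hJ; first exact: measurable_cst.
have hJ' : sites b N `<=` J by apply: subset_trans hJ; exact: sites_le.
rewrite (_ : valley h C N.+1 b = fun t => valley h C N b t ||
  (exceed h b N t && shallow C b N t)); last first.
  by apply/funext => t; exact: valleyS.
by apply: mb_or; [exact: IH|apply: mb_and; [exact: mb_exceed|exact: mb_shallow]].
Qed.

(** Weighting by the martingale is a change of measure under which 1/[yprod b i] has mean at most
    E([yprod b i]) = mu^i. So the sum in [shallow] has bounded mean there, and Markov's inequality
    applies. *)
Lemma Ex_bad_valley h C N b : 0 < C ->
  \sum_(r < N) Ex (fun t => yprod b r t ^+ 2 * (exceed h b r t)%:R *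
     (~~ shallow C b r t)%:R) <= C^-1 * (1 - mu)^-1.
Proof.
move=> C0.
pose u i r := Ex (fun t => (yprod b i t)^-1 * yprod b r t ^+ 2 * (exceed h b r t)%:R).
have u0 i r : 0 <= u i r.
  by apply: Ex_ge0 => t; rewrite !mulr_ge0 ?sqr_ge0 ?invr_ge0// ltW// yprod_gt0.
have sub i r : (i <= r)%N -> sites b i `<=` sites b r.
  exact: sites_le.
have mu' i r : (i <= r)%N ->
    bmf (sites b r) (fun t => (yprod b i t)^-1 * yprod b r t ^+ 2 * (exceed h b r t)%:R).
  move=> ir; apply: bmfM; last by apply: bmf_ind; exact: mb_exceed.
  apply: bmfM; first by apply: bmf_yprodV; exact: sub.
  by rewrite /GRing.exp /=; apply: bmfM; exact: bmf_yprod.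
have H1 (r : 'I_N) : Ex (fun t => yprod b r t ^+ 2 * (exceed h b r t)%:R *
     (~~ shallow C b r t)%:R) <= C^-1 * \sum_(i < r.+1) u i r.
  rewrite -(Ex_sum P w hiid (sites b r)); last by move=> i; apply: mu'; have := ltn_ord i.
  rewrite -(ExZ P w hiid (sites b r)); last first.
    by apply: bmf_sum => i; apply: mu'; have := ltn_ord i.
  apply: (Ex_le P w hiid (sites b r)).
  - apply: bmfM; first exact: bmf_yprod_exceed.
    by apply: bmf_ind; apply: mb_neg; exact: mb_shallow.
  - apply: bmfM; first exact: bmf_cst.
    by apply: bmf_sum => i; apply: mu'; have := ltn_ord i.
  - move=> t; rewrite /shallow -ltNge.
    have -> : \sum_(i < r.+1) (yprod b i t)^-1 * yprod b r t ^+ 2 * (exceed h b r t)%:R =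
        (\sum_(i < r.+1) (yprod b i t)^-1) * (yprod b r t ^+ 2 * (exceed h b r t)%:R).
      by rewrite [RHS]mulr_suml; apply: eq_bigr => i _; rewrite -mulrA.
    rewrite mulrA mulrC; apply: ler_wpM2r.
      by apply: mulr_ge0 => //; exact: sqr_ge0.
    have s0 : 0 <= \sum_(i < r.+1) (yprod b i t)^-1.
      by apply: sumr_ge0 => i _; rewrite invr_ge0 ltW// yprod_gt0.
    case: ltP => [Cs|_] /=; last by rewrite mulr_ge0// invr_ge0 ltW.
    by rewrite mulrC ler_pdivlMr// mul1r ltW.
apply: le_trans (ler_sum _ (fun r _ => H1 r)) _.
rewrite -mulr_sumr ler_wpM2l ?invr_ge0 ?(ltW C0)//.
apply: le_trans (geom_le N).
have -> : \sum_(r < N) \sum_(i < r.+1) u i r = \sum_(i < N) \sum_(i <= r < N) u i r.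
  transitivity (\sum_(r < N) \sum_(i < N) (if (i <= r)%N then u i r else 0)).
    apply: eq_bigr => r _; rewrite -big_mkcond /=.
    by rewrite (big_ord_widen_cond N predT (fun i => u i r)) //; apply: eq_bigl => i.
  rewrite exchange_big /=; apply: eq_bigr => i _.
  rewrite -big_mkcond /= (big_nat_widenl _ 0)//= big_mkord.
  by apply: eq_bigl => r.
apply: ler_sum => i _; rewrite -(Ex_yprod b).
have YV0 t : 0 <= (yprod b i t)^-1 by rewrite invr_ge0 ltW// yprod_gt0.
have st := Ex_stopped h b _ i N (bmf_yprodV b i _ (fun=> id)) YV0 (ltnW (ltn_ord i)).
apply: (@le_trans _ _ (Ex (fun t => (yprod b i t)^-1 * yprod b i t ^+ 2 * (below h b i t)%:R))).
  rewrite -st; apply: ler_wpDl => //.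
  by apply: Ex_ge0 => t; rewrite !mulr_ge0// ltW// yprod_gt0.
apply: (Ex_le P w hiid (sites b i)).
- apply: bmfM; last by apply: bmf_ind; apply: mb_below; exact: sites_pred.
  apply: bmfM; first exact: bmf_yprodV.
  by rewrite /GRing.exp /=; apply: bmfM; exact: bmf_yprod.
- exact: bmf_yprod.
- move=> t; rewrite expr2 mulKf ?lt0r_neq0 ?yprod_gt0//.
  by case: (below h b i t); rewrite ?mulr1 ?mulr0// ltW// yprod_gt0.
Qed.

(** Of the martingale's total mass 1, at most 1/4 has not passed [h] before [N] (there Y^2 <= be h Y
    and E Y = mu^N) and at most 1/4 passes on a climb that is not shallow. The remaining 1/2 is
    carried by valleys, with weight at most (be h)^2. *)
Lemma Ex_valley_ge h C N b : 1 <= h -> 4 / (1 - mu) <= C -> be * h * mu ^+ N <= 4^-1 ->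
  (2 * (be * h) ^+ 2)^-1 <= Ex (fun t => (valley h C N b t)%:R).
Proof.
move=> h1 hC hN.
have m0 : 0 < 1 - mu by have := mu01; lra.
have C0 : 0 < C by apply: lt_le_trans hC; rewrite divr_gt0.
have bh0 : 0 < be * h by have := be_gt1; nra.
have sub r : (r < N)%N -> sites b r `<=` sites b N.
  by move=> rN; apply: sites_le; exact: ltnW.
have bad := Ex_bad_valley h C N b C0.
have Cm : C^-1 * (1 - mu)^-1 <= 4^-1.
  by rewrite -invfM lef_pV2 ?posrE ?mulr_gt0// -ler_pdivrMr.
have tail : Ex (fun t => yprod b N t ^+ 2 * (below h b N t)%:R) <= 4^-1.
  apply: le_trans hN; rewrite -(Ex_yprod b) -(ExZ P w hiid (sites b N)); last exact: bmf_yprod.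
  apply: (Ex_le P w hiid (sites b N)).
  - apply: bmfM; last by apply: bmf_ind; apply: mb_below; exact: sites_pred.
    by rewrite /GRing.exp /=; apply: bmfM; exact: bmf_yprod.
  - by apply: bmfM; [exact: bmf_cst|exact: bmf_yprod].
  - move=> t; case: (boolP (below h b N t)) => bt; rewrite ?mulr1 ?mulr0.
      by rewrite expr2 ler_wpM2r ?exceed_yprod_le// ltW// yprod_gt0.
    by rewrite mulr_ge0 ?ltW// yprod_gt0.
pose G r t := shallow C b r t.
have goodE (r : 'I_N) : Ex (fun t => yprod b r t ^+ 2 * (exceed h b r t)%:R) =
    Ex (fun t => yprod b r t ^+ 2 * (exceed h b r t && G r t)%:R) +
    Ex (fun t => yprod b r t ^+ 2 * (exceed h b r t)%:R * (~~ G r t)%:R).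
  rewrite -(ExD P w hiid (sites b r)).
  - apply: eq_Ex => t; case: (exceed h b r t); case: (G r t) => /=;
      by rewrite ?mulr1 ?mulr0 ?mul0r ?addr0 ?add0r.
  - apply: bmfM; first by rewrite /GRing.exp /=; apply: bmfM; exact: bmf_yprod.
    by apply: bmf_ind; apply: mb_and; [exact: mb_exceed|exact: mb_shallow].
  - apply: bmfM; first exact: bmf_yprod_exceed.
    by apply: bmf_ind; apply: mb_neg; exact: mb_shallow.
have mG (r : 'I_N) : bmf (sites b N) (fun t => (exceed h b r t && G r t)%:R).
  by apply: bmf_ind; apply: mb_and; [apply: mb_exceed|apply: mb_shallow]; apply: sub.
have mgY (r : 'I_N) : bmf (sites b N) (fun t => yprod b r t ^+ 2 * (exceed h b r t && G r t)%:R).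
  apply: bmfM => //.
  by rewrite /GRing.exp /=; apply: bmfM; apply: bmf_yprod; exact: sub.
have good_ge : 2^-1 <= \sum_(r < N) Ex (fun t => yprod b r t ^+ 2 * (exceed h b r t && G r t)%:R).
  have := Ex_stopped1 h b N.
  rewrite (eq_bigr _ (fun r _ => goodE r)) big_split /=; move: bad; rewrite -/(G _ _).
  set g := \sum_(r < N) Ex (fun t => _ * (_ && _)%:R).
  set bd := \sum_(r < N) _ => ? ?; lra.
have : \sum_(r < N) Ex (fun t => yprod b r t ^+ 2 * (exceed h b r t && G r t)%:R) <=
   (be * h) ^+ 2 * Ex (fun t => (valley h C N b t)%:R).
  rewrite -(Ex_sum P w hiid (sites b N))// -(ExZ P w hiid (sites b N)); last first.
    by apply: bmf_ind; exact: mb_valley.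
  apply: (Ex_le P w hiid (sites b N)); first exact: bmf_sum.
    by apply: bmfM; [exact: bmf_cst|by apply: bmf_ind; exact: mb_valley].
  move=> t; apply: (@le_trans _ _ (\sum_(r < N) (be * h) ^+ 2 * (exceed h b r t && G r t)%:R)).
    apply: ler_sum => r _; case: (boolP (exceed h b r t)) => [/andP[bt _]|] /=; last by rewrite !mulr0.
    by rewrite ler_wpM2r// lerXn2r ?nnegrE ?exceed_yprod_le// ltW// yprod_gt0.
  rewrite -mulr_sumr ler_wpM2l ?sqr_ge0//; exact: sum_valley.
move=> /(le_trans good_ge).
by rewrite invfM -ler_pdivrMl ?exprn_gt0// mulrC.
Qed.

Lemma Ex_valley_le h C N b : 0 < h -> Ex (fun t => (valley h C N b t)%:R) <= h ^- 2.
Proof.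
move=> h0; apply: le_trans (Ex_exceeds h b N h0).
apply: (Ex_le P w hiid (sites b N)).
- by apply: bmf_ind; exact: mb_valley.
- by apply: bmf_ind; apply: mb_neg; apply: mb_below; exact: sites_pred.
- move=> t; case: (boolP (valley h C N b t)) => [v|_]; last by case: (below _ _ _ _).
  by rewrite (valley_exceeds _ _ _ _ _ v).
Qed.

(* Either the first valley ends before the second begins, and the two are independent,
   or [yprod] has not dropped below [C^-1] between the two bottoms. *)
Lemma Ex_two_valleys h C N b i : 0 < h -> 0 < C ->
  Ex (fun t => (valley h C N b t && valley h C N (b + i%:Z) t)%:R) <=
  h ^- 2 * h ^- 2 + C * mu ^+ i * h ^- 2.
Proof.
move=> h0 C0.
set b' := b + i%:Z; set J := sites b (i + N).
have sb : sites b i `<=` J by apply: sites_le; exact: leq_addr.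
have sb' : sites b' N `<=` J by exact: sites_tail.
have sN : sites b N `<=` J by apply: sites_le; exact: leq_addl.
have dis : sites b i `&` sites b' N = set0 by exact: sites_disjoint.
have mv : bmf (sites b' N) (fun t => (valley h C N b' t)%:R).
  by apply: bmf_ind; exact: mb_valley.
have mv' := bmf_mono w _ _ _ sb' mv.
have mbe : bmf (sites b i) (fun t => (~~ below h b i.+1 t)%:R).
  by apply: bmf_ind; apply: mb_neg; exact: mb_below.
have mY : bmf (sites b i) (fun t => C * yprod b i t).
  by apply: bmfM; [exact: bmf_cst|exact: bmf_yprod].
apply: (@le_trans _ _ (Ex (fun t => (~~ below h b i.+1 t)%:R * (valley h C N b' t)%:R +
    C * yprod b i t * (valley h C N b' t)%:R))).
  apply: (Ex_le P w hiid J).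
  - by apply: bmf_ind; apply: mb_and; apply: mb_valley.
  - by apply: bmfD; apply: bmfM => //; apply: bmf_mono sb _.
  - move=> t; case: (boolP (valley h C N b' t)) => [_|_]; last by rewrite andbF !mulr0 addr0.
    rewrite andbT !mulr1; case: (boolP (valley h C N b t)) => [|_]; last first.
      by rewrite addr_ge0// mulr_ge0// ltW// yprod_gt0.
    move=> /hasP[r _ /andP[er gr]].
    case: (boolP (below h b i.+1 t)) => bt /=; last first.
      by rewrite lerDl mulr_ge0// ltW// yprod_gt0.
    (* If the level is not reached up to index i, the first valley extends at least to i, and the
       i-th term of [shallow] alone gives 1 <= C [yprod b i]. *)
    have ir : (i < r.+1)%N.
      by rewrite ltnS leqNgt; apply/negP => /leqW ri; have := exceed_below _ _ _ i.+1 _ er; rewrite bt => /(_ ri).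
    rewrite add0r -ler_pdivrMr ?yprod_gt0// mul1r; apply: le_trans gr.
    rewrite (bigD1 (Ordinal ir))//= lerDl; apply: sumr_ge0 => k _.
    by rewrite invr_ge0 ltW// yprod_gt0.
rewrite (ExD P w hiid J); last 2 first.
- by apply: bmfM => //; apply: bmf_mono sb _.
- by apply: bmfM => //; apply: bmf_mono sb _.
have mv0 t : 0 <= (valley h C N b' t)%:R :> R by [].
apply: lerD.
- rewrite (ExM_indep_ge0 P w hiid (sites b i) (sites b' N))//.
  by apply: ler_pM; rewrite ?Ex_ge0 ?Ex_exceeds ?Ex_valley_le.
- rewrite (ExM_indep_ge0 P w hiid (sites b i) (sites b' N))//; last first.
    by move=> t; rewrite mulr_ge0// ltW// yprod_gt0.
  rewrite (ExZ P w hiid (sites b i)) ?Ex_yprod; last exact: bmf_yprod.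
  rewrite ler_wpM2l ?Ex_valley_le// mulr_ge0 ?exprn_ge0//; [lra|].
  by have := mu01; lra.
Qed.

(** The sum of e^(V(m) - V(j)) over sites j <= m of the stretch: up to ellipticity, the mean time to
    cross it, not counting excursions to the left of [a]. *)
Definition mass (a : int) (l : nat) (t : T) : R :=
  \sum_(j < l) \sum_(i < l - j) xprod (a + j%:Z) i t.

Lemma bmf_mass a l : bmf (sites a l) (mass a l).
Proof.
by apply: bmf_sum => j; apply: bmf_sum => i; apply: bmf_xprod; apply: sites_tail_le; exact: ltnW.
Qed.

(** Without truncation the mean of [mass] grows like nu^l; only climbs that stay below [h] are
    kept. *)
Definition trunc_mass (h : R) (a : int) (l : nat) (t : T) : R :=
  \sum_(j < l) \sum_(i < l - j) xprod (a + j%:Z) i t * (below h (a + j%:Z) i.+1 t)%:R.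

Lemma bmf_trunc_mass h a l : bmf (sites a l) (trunc_mass h a l).
Proof.
apply: bmf_sum => j; apply: bmf_sum => i; apply: bmfM.
  by apply: bmf_xprod; apply: sites_tail_le; exact: ltnW.
by apply: bmf_ind; apply: mb_below; apply: sites_tail_le; exact: (ltnW (ltn_ord i)).
Qed.

(** Either some site of the stretch starts a climb above [h], at cost h^-2 per site, or the mass
    equals its truncation, whose mean is at most l (be h)^(q-2)/(nu - 1); dividing by eta h^q leaves
    h^-2 again. *)
Lemma Ex_mass_large h eta a l : 1 <= h -> 0 < eta ->
  Ex (fun t => (eta * h `^ q < mass a l t)%R%:R) <=
  l%:R * h ^- 2 * (1 + be `^ (q - 2) / (eta * (nu - 1))).
Proof.
move=> h1 e0; have h0 : 0 < h by lra.
have H0 : 0 < eta * h `^ q by rewrite mulr_gt0// powR_gt0.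
have nu1 : 0 < nu - 1 by have := nu_gt1; lra.
have mbl (j : 'I_l) : bmf (sites a l) (fun t => (~~ below h (a + j%:Z) (l - j) t)%:R).
  by apply: bmf_ind; apply: mb_neg; apply: mb_below; apply: sites_tail_le; exact: leq_pred.
have msum : bmf (sites a l) (fun t => \sum_(j < l) (~~ below h (a + j%:Z) (l - j) t)%:R).
  exact: bmf_sum.
have mtr : bmf (sites a l) (fun t => (eta * h `^ q)^-1 * trunc_mass h a l t).
  by apply: bmfM; [exact: bmf_cst|exact: bmf_trunc_mass].
apply: (@le_trans _ _ (Ex (fun t => \sum_(j < l) (~~ below h (a + j%:Z) (l - j) t)%:R +
    (eta * h `^ q)^-1 * trunc_mass h a l t))).
  apply: (Ex_le P w hiid (sites a l)).
  - by apply: bmf_ind; apply: mb_lt; [exact: bmf_cst|exact: bmf_mass].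
  - exact: bmfD.
  - move=> t.
    have tr0 : 0 <= trunc_mass h a l t.
      by apply: sumr_ge0 => j _; apply: sumr_ge0 => i _; rewrite mulr_ge0// ltW// xprod_gt0.
    have s0 : 0 <= \sum_(j < l) (~~ below h (a + j%:Z) (l - j) t)%:R :> R by apply: sumr_ge0.
    case: ltP => [Cs|_] /=; last by rewrite addr_ge0// mulr_ge0// invr_ge0 ltW.
    have [/existsP[j bj]|] := boolP [exists j : 'I_l, ~~ below h (a + j%:Z) (l - j) t].
      apply: ler_wpDr; first by rewrite mulr_ge0// invr_ge0 ltW.
      by rewrite (bigD1 j)//= bj lerDl sumr_ge0.
    move=> /existsPn nb; apply: ler_wpDl => //.
    rewrite mulrC ler_pdivlMr// mul1r; apply: (le_trans (ltW Cs)).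
    apply: ler_sum => j _; apply: ler_sum => i _.
    have -> : below h (a + j%:Z) i.+1 t; last by rewrite mulr1.
    by apply: (below_le _ _ _ (l - j)) => //; have := nb j; rewrite negbK.
rewrite (ExD P w hiid (sites a l))// (ExZ P w hiid (sites a l)); last exact: bmf_trunc_mass.
rewrite (Ex_sum P w hiid (sites a l))//.
have E1 : \sum_(j < l) Ex (fun t => (~~ below h (a + (j : 'I_l)%:Z) (l - j) t)%:R) <= l%:R * h ^- 2.
  rewrite mulr_natl -[l in leRHS]card_ord -sumr_const; apply: ler_sum => j _.
  exact: Ex_exceeds.
have E2 : Ex (trunc_mass h a l) <= l%:R * ((be * h) `^ (q - 2) / (nu - 1)).
  rewrite /trunc_mass (Ex_sum P w hiid (sites a l)); last first.
    move=> j; apply: bmf_sum => i; apply: bmfM.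
      by apply: bmf_xprod; apply: sites_tail_le; exact: ltnW.
    by apply: bmf_ind; apply: mb_below; apply: sites_tail_le; exact: (ltnW (ltn_ord i)).
  rewrite mulr_natl -[l in leRHS]card_ord -sumr_const; apply: ler_sum => j _.
  rewrite (Ex_sum P w hiid (sites a l)); first exact: Ex_truncated_sum.
  move=> i; apply: bmfM.
    by apply: bmf_xprod; apply: sites_tail_le; exact: ltnW.
  by apply: bmf_ind; apply: mb_below; apply: sites_tail_le; exact: (ltnW (ltn_ord i)).
rewrite mulrDr mulr1; apply: lerD => //.
have iH : 0 <= (eta * h `^ q)^-1 by rewrite invr_ge0 ltW.
apply: le_trans (ler_wpM2l iH E2) _.
rewrite powRM ?(ltW h0) ?powR_split//; last by have := be_gt1; lra.
have hq : 0 < h `^ (q - 2) by rewrite powR_gt0.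
rewrite le_eqVlt; apply/orP; left; apply/eqP.
by field; rewrite !lt0r_neq0.
Qed.

(** In order: the crossing time of the stretch; the weight with which the past enters that time; the
    depth of the bottom below the start, which makes the mass of the past negligible; the mass of
    the left slope relative to the bottom. *)
Definition approach (h eta del C : R) (a : int) (l : nat) (t : T) : bool :=
  [&& mass a l t <= eta * h `^ q, \sum_(i < l) yprod a i t <= C,
      yprod a l t <= del & \sum_(j < l) yprod (a + j%:Z) (l - j) t <= C].

Lemma mb_approach h eta del C a l : mb (sites a l) (approach h eta del C a l).
Proof.
apply: mb_and; first by apply: mb_le; [exact: bmf_mass|exact: bmf_cst].
apply: mb_and; first apply: mb_le; [|exact: bmf_cst|].
  by apply: bmf_sum => i; apply: bmf_yprod; apply: sites_le; exact: ltnW.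
apply: mb_and; first by apply: mb_le; [exact: bmf_yprod|exact: bmf_cst].
apply: mb_le; [|exact: bmf_cst].
by apply: bmf_sum => i; apply: bmf_yprod; exact: sites_tail_le.
Qed.

Lemma Ex_approach_ge h eta del C a l : 1 <= h -> 0 < eta -> 0 < del -> 0 < C ->
  1 - l%:R * h ^- 2 * (1 + be `^ (q - 2) / (eta * (nu - 1))) - C^-1 * (1 - mu)^-1
    - del^-1 * mu ^+ l - C^-1 * (1 - mu)^-1 <= Ex (fun t => (approach h eta del C a l t)%:R).
Proof.
move=> h1 e0 d0' C0.
have m1 : bmf (sites a l) (fun t => \sum_(i < l) yprod a i t).
  by apply: bmf_sum => i; apply: bmf_yprod; apply: sites_le; exact: ltnW.
have m2 : bmf (sites a l) (yprod a l) by exact: bmf_yprod.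
have m3 : bmf (sites a l) (fun t => \sum_(j < l) yprod (a + j%:Z) (l - j) t).
  by apply: bmf_sum => i; apply: bmf_yprod; exact: sites_tail_le.
have p1 := Ex_mass_large h eta a l h1 e0.
have p2 : Ex (fun t => (C < \sum_(i < l) yprod a i t)%R%:R) <= C^-1 * (1 - mu)^-1.
  apply: le_trans (markov_Ex _ _ _ m1 C0 _) _.
    by move=> t; apply: sumr_ge0 => i _; rewrite ltW// yprod_gt0.
  rewrite ler_wpM2l ?invr_ge0 ?(ltW C0)//.
  rewrite (Ex_sum P w hiid (sites a l)).
    by under eq_bigr do rewrite Ex_yprod; exact: geom_le.
  by move=> i; apply: bmf_yprod; apply: sites_le; exact: ltnW.
have p3 : Ex (fun t => (del < yprod a l t)%R%:R) <= del^-1 * mu ^+ l.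
  apply: le_trans (markov_Ex _ _ _ m2 d0' _) _; last by rewrite Ex_yprod.
  by move=> t; rewrite ltW// yprod_gt0.
have p4 : Ex (fun t => (C < \sum_(j < l) yprod (a + j%:Z) (l - j) t)%R%:R) <= C^-1 * (1 - mu)^-1.
  apply: le_trans (markov_Ex _ _ _ m3 C0 _) _.
    by move=> t; apply: sumr_ge0 => i _; rewrite ltW// yprod_gt0.
  rewrite ler_wpM2l ?invr_ge0 ?(ltW C0)//.
  rewrite (Ex_sum P w hiid (sites a l)); last first.
    by move=> i; apply: bmf_yprod; exact: sites_tail_le.
  apply: le_trans (geom_le l.+1).
  under eq_bigr do rewrite Ex_yprod.
  by rewrite (sum_subn_ord R (fun i => mu ^+ i)) big_ord_recl /= expr0; exact: ler_wpDl.
have i1 : bmf (sites a l) (fun t => (eta * h `^ q < mass a l t)%R%:R).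
  by apply: bmf_ind; apply: mb_lt; [exact: bmf_cst|exact: bmf_mass].
have i2 : bmf (sites a l) (fun t => (C < \sum_(i < l) yprod a i t)%R%:R).
  by apply: bmf_ind; apply: mb_lt => //; exact: bmf_cst.
have i3 : bmf (sites a l) (fun t => (del < yprod a l t)%R%:R).
  by apply: bmf_ind; apply: mb_lt => //; exact: bmf_cst.
have i4 : bmf (sites a l) (fun t => (C < \sum_(j < l) yprod (a + j%:Z) (l - j) t)%R%:R).
  by apply: bmf_ind; apply: mb_lt => //; exact: bmf_cst.
apply: (@le_trans _ _ (Ex (fun t => 1 - (eta * h `^ q < mass a l t)%R%:R
   - (C < \sum_(i < l) yprod a i t)%R%:R - (del < yprod a l t)%R%:R
   - (C < \sum_(j < l) yprod (a + j%:Z) (l - j) t)%R%:R))).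
  have j0 := bmf_cst w (sites a l) 1.
  have j1 := bmfB w _ _ _ j0 i1; have j2 := bmfB w _ _ _ j1 i2; have j3 := bmfB w _ _ _ j2 i3.
  rewrite (ExB P w hiid _ _ _ j3 i4) (ExB P w hiid _ _ _ j2 i3) (ExB P w hiid _ _ _ j1 i2).
  by rewrite (ExB P w hiid _ _ _ j0 i1) Ex_cst; lra.
apply: (Ex_le P w hiid (sites a l)).
- by do 4 (apply: bmfB => //); exact: bmf_cst.
- by apply: bmf_ind; exact: mb_approach.
- by move=> t; rewrite /approach !ltNge; exact: union_bound4.
Qed.

(** The 8 makes the Markov bounds for the two sums in [approach] equal to 1/8, and exceeds the 4
    required by [Ex_valley_ge]. *)
Definition valley_bound : R := 8 / (1 - mu).
Local Notation C0 := valley_bound.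

Lemma valley_bound_gt0 : 0 < C0.
Proof. by rewrite divr_gt0// subr_gt0; case/andP: mu01. Qed.

(** * A block with many candidate bottoms *)

Section block.
Variables (h eta del : R) (n : int) (g s m N : nat).
Hypotheses (h1 : 1 <= h) (e0 : 0 < eta) (del0 : 0 < del) (s1 : (0 < s)%N).

(** The offset [g] puts even the first candidate far below the start of the block; the spacing [s]
    decorrelates different candidates. *)
Definition cand (i : nat) : nat := (g + s * i)%N.

Definition block (t : T) : bool :=
  has (fun i => approach h eta del C0 n (cand i) t && valley h C0 N (n + (cand i)%:Z) t)
    (iota 0 m).

Lemma mb_block : mb (sites n (cand m + N)) block.
Proof.
rewrite (_ : block = fun t => has (fun i : 'I_m => approach h eta del C0 n (cand i) t &&
    valley h C0 N (n + (cand i)%:Z) t) (enum 'I_m)); last first.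
  by apply/funext => t; rewrite /block -val_enum_ord has_map.
apply: mb_has => i.
have le_im : (cand i <= cand m)%N by rewrite leq_add2l leq_mul2l ltnW ?orbT.
apply: mb_and.
  apply: (mb_mono w (sites n (cand i))); last exact: mb_approach.
  by apply: sites_le; apply: leq_trans le_im _; exact: leq_addr.
by apply: mb_valley; apply: sites_tail; rewrite leq_add2r.
Qed.

Let K0 := 1 + be `^ (q - 2) / (eta * (nu - 1)).

Lemma K0_ge0 : 0 <= K0.
Proof.
rewrite addr_ge0// divr_ge0 ?powR_ge0// mulr_ge0// ?(ltW e0)// subr_ge0 ltW//.
Qed.

(** A candidate has a good approach with probability at least 1/2 and, independently, a valley with
    probability at least 1/(2 (be h)^2). A pair of valleys costs h^-4 plus a term geometric in their
    distance. For m h^-2 <= al and the given spacing, all pairs take at most a quarter of the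
    first-order sum. *)
Lemma Ex_block_ge (al : R) : 0 < al -> al <= (be ^- 2) / 32 ->
  16 * s%:R * al * K0 <= 1 -> 16 * g%:R * h ^- 2 * K0 <= 1 ->
  del^-1 * mu ^+ g <= 8^-1 -> mu ^+ s <= 2^-1 -> 2 * C0 * mu ^+ s <= (be ^- 2) / 32 ->
  al / 2 <= m%:R * h ^- 2 <= al -> be * h * mu ^+ N <= 4^-1 ->
  al * (be ^- 2) / 16 <= Ex (fun t => (block t)%:R).
Proof.
move=> al0 alle sal gh hg hs hCs mh hN.
have h0 : 0 < h by apply: lt_le_trans h1.
have C00 := valley_bound_gt0.
have m0 : 0 < 1 - mu by rewrite subr_gt0; case/andP: mu01.
have mu_ge0 : 0 <= mu by case/andP: mu01 => /ltW.
have mu_le1 : mu <= 1 by case/andP: mu01 => _ /ltW.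
have be0 : 0 < be by apply: lt_trans be_gt1.
have hV0 : 0 <= h ^- 2 by rewrite invr_ge0 exprn_ge0// ltW.
set J := sites n (cand m + N).
have le_im i : (i < m)%N -> (cand i <= cand m)%N.
  by move=> im; rewrite leq_add2l leq_mul2l ltnW ?orbT.
have mA i : (i < m)%N -> mb J (approach h eta del C0 n (cand i)).
  move=> im; apply: (mb_mono w (sites n (cand i))); last exact: mb_approach.
  by apply: sites_le; apply: leq_trans (le_im i im) _; exact: leq_addr.
have mV i : (i < m)%N -> mb J (valley h C0 N (n + (cand i)%:Z)).
  by move=> im; apply: mb_valley; apply: sites_tail; rewrite leq_add2r le_im.
have hA i : (i < m)%N -> 2^-1 <= Ex (fun t => (approach h eta del C0 n (cand i) t)%:R).
  move=> im; apply: le_trans (Ex_approach_ge h eta del C0 n (cand i) h1 e0 del0 C00).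
  have b1 : (cand i)%:R * h ^- 2 * K0 <= 8^-1.
    apply: (approach_budget _ _ g s m _ _ (m%:R * h ^- 2) al) => //.
    - exact: le_im.
    - exact: K0_ge0.
    - by case/andP: mh.
  have b2 : C0^-1 * (1 - mu)^-1 <= 8^-1.
    by rewrite /valley_bound invf_div mulrAC divff ?mul1r ?lt0r_neq0.
  have b3 : del^-1 * mu ^+ cand i <= 8^-1.
    apply: le_trans hg; rewrite ler_wpM2l ?invr_ge0 ?(ltW del0)//.
    by apply: ler_wiXn2l => //; exact: leq_addr.
  rewrite -/K0; exact: four_eighths b1 b2 b3.
have hAV i : (i < m)%N ->
    (be ^- 2 / 4) * h ^- 2 <= Ex (fun t => (approach h eta del C0 n (cand i) t)%:R *
      (valley h C0 N (n + (cand i)%:Z) t)%:R).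
  move=> im.
  rewrite (ExM_indep_ge0 P w hiid (sites n (cand i)) (sites (n + (cand i)%:Z) N))//.
  - have hv : 4 / (1 - mu) <= C0 by rewrite ler_wpM2r ?invr_ge0 ?(ltW m0)// ler_nat.
    have V1 := Ex_valley_ge h C0 N (n + (cand i)%:Z) h1 hv hN.
    have A1 := hA i im.
    have -> : be ^- 2 / 4 * h ^- 2 = 2^-1 * (2 * (be * h) ^+ 2)^-1.
      by field; rewrite !lt0r_neq0.
    by apply: ler_pM => //; rewrite invr_ge0 mulr_ge0// sqr_ge0.
  - exact: sites_disjoint.
  - by apply: bmf_ind; exact: mb_approach.
  - by apply: bmf_ind; exact: mb_valley.
have hVV i j : (i < j)%N -> (j < m)%N ->
    Ex (fun t => (valley h C0 N (n + (cand i)%:Z) t && valley h C0 N (n + (cand j)%:Z) t)%:R) <=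
    h ^- 2 * h ^- 2 + C0 * (mu ^+ s) ^+ (j - i) * h ^- 2.
  move=> ij jm.
  have -> : n + (cand j)%:Z = n + (cand i)%:Z + (s * (j - i))%N%:Z.
    by rewrite -addrA -PoszD /cand -addnA -mulnDr subnKC ?(ltnW ij).
  by rewrite -exprM; exact: Ex_two_valleys.
have lb : \sum_(i < m) Ex (fun t => (approach h eta del C0 n (cand i) t)%:R *
      (valley h C0 N (n + (cand i)%:Z) t)%:R) -
   \sum_(j < m) \sum_(i < j) Ex (fun t => (valley h C0 N (n + (cand i)%:Z) t &&
      valley h C0 N (n + (cand j)%:Z) t)%:R) <= Ex (fun t => (block t)%:R).
  have f1 (i : 'I_m) : bmf J (fun t => (approach h eta del C0 n (cand i) t)%:R *
      (valley h C0 N (n + (cand i)%:Z) t)%:R).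
    by apply: bmfM; apply: bmf_ind; [exact: mA|exact: mV].
  have f2 (j : 'I_m) (i : 'I_j) : bmf J (fun t => (valley h C0 N (n + (cand i)%:Z) t &&
      valley h C0 N (n + (cand j)%:Z) t)%:R).
    apply: bmf_ind; apply: mb_and; apply: mV => //; exact: ltn_trans (ltn_ord j).
  rewrite -(Ex_sum P w hiid J)//.
  under [X in _ - X]eq_bigr => j _ do rewrite -(Ex_sum P w hiid J)//.
  rewrite -(Ex_sum P w hiid J); last by move=> j; exact: bmf_sum.
  have g1 : bmf J (fun t => \sum_(i < m) (approach h eta del C0 n (cand i) t)%:R *
      (valley h C0 N (n + (cand i)%:Z) t)%:R) by exact: bmf_sum.
  have g2 : bmf J (fun t => \sum_(j < m) \sum_(i < j) (valley h C0 N (n + (cand i)%:Z) t &&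
      valley h C0 N (n + (cand j)%:Z) t)%:R) by apply: bmf_sum => j; exact: bmf_sum.
  rewrite -(ExB P w hiid J)//; apply: (Ex_le P w hiid J); first exact: bmfB.
    by apply: bmf_ind; exact: mb_block.
  move=> t; apply: le_trans (bonferroni R (fun i => approach h eta del C0 n (cand i) t &&
    valley h C0 N (n + (cand i)%:Z) t) (fun i => valley h C0 N (n + (cand i)%:Z) t) m _).
    rewrite lerD2r; apply: ler_sum => i _.
    by case: (approach _ _ _ _ _ _ _); case: (valley _ _ _ _ _); rewrite ?mulr1 ?mulr0.
  by move=> i /andP[].
apply: le_trans lb.
set u := m%:R * h ^- 2 in mh *.
have be20 : 0 < be ^- 2 by rewrite invr_gt0 exprn_gt0.
apply: le_trans (block_budget R u al (be ^- 2) (2 * C0 * mu ^+ s) be20 alle hCs mh al0) _.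
rewrite -addrA -opprD; apply: lerB.
  have -> : u * (be ^- 2 / 4) = \sum_(i < m) (be ^- 2 / 4) * h ^- 2.
    by rewrite sumr_const card_ord /u -mulr_natl; ring.
  by apply: ler_sum => i _; exact: hAV.
apply: (@le_trans _ _ (\sum_(j < m) (m%:R * (h ^- 2 * h ^- 2) + C0 * h ^- 2 * (2 * mu ^+ s)))).
  apply: ler_sum => j _.
  apply: (@le_trans _ _ (\sum_(i < j) (h ^- 2 * h ^- 2 + C0 * (mu ^+ s) ^+ (j - i) * h ^- 2))).
    by apply: ler_sum => i _; exact: hVV.
  rewrite big_split /=; apply: lerD.
    rewrite sumr_const card_ord -[leLHS]mulr_natl ler_wpM2r ?mulr_ge0//.
    by rewrite ler_nat ltnW.
  have -> : \sum_(i < j) C0 * (mu ^+ s) ^+ (j - i) * h ^- 2 =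
      C0 * h ^- 2 * \sum_(i < j) (mu ^+ s) ^+ (j - i).
    by rewrite mulr_sumr; apply: eq_bigr => i _; rewrite mulrAC.
  apply: ler_wpM2l; first by rewrite mulr_ge0// ltW.
  by apply: sum_exp_gap; rewrite exprn_ge0.
rewrite sumr_const card_ord -[leLHS]mulr_natl /u le_eqVlt; apply/orP; left; apply/eqP; ring.
Qed.
End block.

(** [p] precedes [n], [del] and [Hm] because it involves only [be] and [al], which is fixed by
    [eta]. A small [del] merely enlarges the offset [g], and this is compensated by a larger [h]. *)
Lemma block_exists (eta : R) : 0 < eta -> exists2 p : R, 0 < p &
  forall (n : int) (del Hm : R), 0 < del -> exists (len tm : nat) (E : T -> bool),
  [/\ (0 < len)%N, mb (sites n len) E, p <= Ex (fun t => (E t)%:R), Hm <= tm%:R &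
   forall t, E t -> exists l r : nat,
    [/\ mass n l t <= eta * (2 * tm%:R), \sum_(i < l) yprod n i t <= C0, yprod n l t <= del,
        \sum_(j < l) yprod (n + j%:Z) (l - j) t <= C0 &
        2 * tm%:R <= xprod (n + l%:Z) r t /\ shallow C0 (n + l%:Z) r t]].
Proof.
move=> e0; have C00 := valley_bound_gt0.
have be0 : 0 < be by apply: lt_trans be_gt1.
have B0 : 0 < be ^- 2 by rewrite invr_gt0 exprn_gt0.
have mu01' : 0 <= mu < 1 by case/andP: mu01 => /ltW -> ->.
have mu_ge0 : 0 <= mu by case/andP: mu01'.
have mu_le1 : mu <= 1 by case/andP: mu01 => _ /ltW.
set K0 := 1 + be `^ (q - 2) / (eta * (nu - 1)).
have K00 : 0 < K0.
  rewrite ltr_pwDl// divr_ge0 ?powR_ge0// mulr_ge0// ?(ltW e0)// subr_ge0 ltW//.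
have es0 : 0 < Num.min 2^-1 (be ^- 2 / 32 / (2 * C0)).
  by rewrite lt_min invr_gt0 ltr0n/= divr_gt0// ?divr_gt0// mulr_gt0.
have [s' hs'] := expr_small R mu _ mu01' es0.
pose s := s'.+1.
have hs : mu ^+ s <= Num.min 2^-1 (be ^- 2 / 32 / (2 * C0)).
  by apply: le_trans hs'; apply: ler_wiXn2l.
have hs2 : mu ^+ s <= 2^-1 by move: hs; rewrite le_min => /andP[].
have hCs : 2 * C0 * mu ^+ s <= be ^- 2 / 32.
  have C20 : 0 < 2 * C0 by rewrite mulr_gt0.
  by move: hs; rewrite le_min => /andP[_]; rewrite (ler_pdivlMr _ _ C20) [X in X <= _]mulrC.
pose al := Num.min (be ^- 2 / 32) (16 * s%:R * K0)^-1.
have sK : 0 < 16 * s%:R * K0 by rewrite !mulr_gt0// ltr0n.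
have al0 : 0 < al by rewrite lt_min divr_gt0//= invr_gt0.
have al1 : al <= be ^- 2 / 32 by rewrite ge_min lexx.
have al2 : 16 * s%:R * al * K0 <= 1.
  have : al <= (16 * s%:R * K0)^-1 by rewrite ge_min lexx orbT.
  by rewrite -[_^-1]mul1r (ler_pdivlMr _ _ sK) mulrC mulrAC.
exists (al * be ^- 2 / 16); first by rewrite divr_gt0// mulr_gt0.
move=> n del Hm del0.
have e1 : 0 < del / 8 by rewrite divr_gt0.
have [g hg] := expr_small R mu _ mu01' e1.
have hg' : del^-1 * mu ^+ g <= 8^-1 by rewrite mulrC ler_pdivrMr// mulrC.
have q0 : 0 < q by apply: lt_trans q_gt2.
(* The three terms secure 1 <= h, al h^2 >= 2 (so rounding down to [m] loses at most half), and 16 g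
   K0 <= h^2. *)
pose h0 := 1 + 2 / al + 16 * g%:R * K0.
have gK : 0 <= 16 * g%:R * K0 by rewrite !mulr_ge0// ltW.
have h01 : 1 <= h0 by rewrite /h0 -addrA lerDl addr_ge0// divr_ge0// ltW.
pose tm := Num.bound (Num.max Hm (h0 `^ q)).
have htm : Num.max Hm (h0 `^ q) < tm%:R.
  apply: archi_boundP; rewrite le_max; apply/orP; right; exact: powR_ge0.
have tmH : Hm <= tm%:R by apply: le_trans (ltW htm); rewrite le_max lexx.
have tmh : h0 `^ q <= 2 * tm%:R.
  apply: (@le_trans _ _ tm%:R).
    by apply: le_trans (ltW htm); rewrite le_max lexx orbT.
  by rewrite mulr_natl mulr2n lerDl.
pose h := (2 * tm%:R) `^ q^-1.
have hq : h `^ q = 2 * tm%:R.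
  by rewrite /h -powRrM mulVf ?lt0r_neq0// powRr1// mulr_ge0.
have h0h : h0 <= h.
  have -> : h0 = (h0 `^ q) `^ q^-1.
    by rewrite -powRrM mulfV ?lt0r_neq0// powRr1// (le_trans _ h01).
  by apply: ge0_ler_powR => //; rewrite ?nnegrE ?powR_ge0 ?invr_ge0 ?(ltW q0)//.
have h1 : 1 <= h by apply: le_trans h0h.
have hpos : 0 < h by apply: lt_le_trans h1.
have hh2 : h0 <= h ^+ 2.
  by apply: le_trans h0h _; rewrite expr2 ler_peMl// ltW.
have h20 : 0 < h ^+ 2 by rewrite exprn_gt0.
have hg2 : 16 * g%:R * h ^- 2 * K0 <= 1.
  rewrite mulrAC ler_pdivrMr// mul1r; apply: le_trans hh2.
  by rewrite /h0 lerDr addr_ge0// divr_ge0// ltW.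
pose m := Num.truncn (al * h ^+ 2).
have ah0 : 0 <= al * h ^+ 2 by rewrite mulr_ge0// ltW.
have ah2 : 2 <= al * h ^+ 2.
  rewrite mulrC -ler_pdivrMr//; apply: le_trans hh2.
  by rewrite /h0 addrAC lerDr addr_ge0.
have hm : al / 2 <= m%:R * h ^- 2 <= al.
  have := truncn_itv ah0; rewrite -/m => /andP[ml mu'].
  rewrite (ler_pdivrMr _ _ h20) ml andbT (ler_pdivlMr _ _ h20).
  move: mu'; rewrite -natr1 => mu'.
  exact: trunc_half ah2 mu'.
(* The horizon is chosen last and may depend on [h]: it affects the length of the block but not the
   bound [p]. *)
have e2 : 0 < (4 * (be * h))^-1 by rewrite invr_gt0 !mulr_gt0.
have [N hN] := expr_small R mu _ mu01' e2.
have hN' : be * h * mu ^+ N <= 4^-1.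
  have bh0 : 0 < be * h by rewrite mulr_gt0.
  by move: hN; rewrite invfM (ler_pdivlMr _ _ bh0) [X in X <= _]mulrC.
exists (cand g s m + N).+1, tm, (block h eta del n g s m N); split => //.
- by apply: (mb_mono w _ _ _ _ (mb_block h eta del n g s m N)); exact: sites_le.
- exact: Ex_block_ge.
- move=> t /hasP[i _ /andP[/and4P[a1 a2 a3 a4] /hasP[r _ /andP[/andP[_ er] sh]]]].
  exists (cand g s i), r; split => //; first by rewrite -hq.
  split => //; rewrite -hq; apply: ge0_ler_powR => //; rewrite ?nnegrE ?(ltW q0) ?(ltW hpos)//.
  by rewrite ltW// yprod_gt0.
Qed.

End environment.

(** * Almost sure statements *)

Section almost_sure.
Context {d0 : measure_display} {T : measurableType d0} {R : realType}.
Context (P : probability T R) (w : int -> T -> R).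
Hypothesis hiid : iid_family P w.

Lemma measurable_mb I b : mb w I b -> measurable [set t | b t].
Proof.
move=> hb; apply: (sigma_on_measurable P w hiid I).
by have := hb measurableT [set true]; rewrite setTI; apply.
Qed.

Lemma null_of_small (A : set T) : (forall e : R, 0 < e -> (P A <= e%:E)%E) -> P A = 0%E.
Proof.
move=> hA; apply/eqP; rewrite eq_le measure_ge0 andbT.
by apply/lee_addgt0Pr => e /hA; rewrite add0e.
Qed.

(** Second Borel-Cantelli lemma: the events live on disjoint stretches of sites, so j consecutive
    failures have probability at most (1 - p)^j. *)
Lemma ae_infinitely_often (nk : nat -> nat) (E : nat -> T -> bool) (p : R) : 0 < p ->
  (forall k, (nk k <= nk k.+1)%N) ->
  (forall k, mb w (sites (nk k)%:Z (nk k.+1 - nk k)%N) (E k)) ->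
  (forall k, p <= Ex P (fun t => (E k t)%:R)) ->
  {ae P, forall t, forall K, exists2 k, (K <= k)%N & E k t}.
Proof.
move=> p0 nk_le mE hE.
have nk_mono K j : (nk K <= nk (K + j))%N.
  by elim: j => [|j IH]; rewrite ?addn0// addnS (leq_trans IH).
pose F K j t := all (fun i => ~~ E (K + i)%N t) (iota 0 j).
have FS K j t : F K j.+1 t = F K j t && ~~ E (K + j)%N t.
  by rewrite /F -addn1 iotaD all_cat /= add0n andbT.
have mF K j : mb w (sites (nk K)%:Z (nk (K + j)%N - nk K)%N) (F K j).
  elim: j => [|j IH]; first exact: measurable_cst.
  rewrite (_ : F K j.+1 = fun t => F K j t && ~~ E (K + j)%N t); last first.
    by apply/funext => t; exact: FS.
  apply: mb_and.
    by apply: (mb_mono w _ _ _ _ IH); apply: sites_le; apply: leq_sub2r; rewrite addnS.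
  apply: mb_neg; apply: (mb_mono w _ _ _ _ (mE (K + j)%N)) => x; rewrite /sites /= addnS.
  by have := nk_mono K j; have := nk_le (K + j)%N; lia.
have p1 : p <= 1.
  apply: (le_trans (hE 0%N)); rewrite -[leRHS](Ex_cst P).
  apply: (Ex_le P w hiid _ _ _ (bmf_ind w _ _ (mE 0%N)) (bmf_cst w _ 1)) => t.
  by rewrite lern1 leq_b1.
have hF K j : Ex P (fun t => (F K j t)%:R) <= (1 - p) ^+ j.
  elim: j => [|j IH]; first by rewrite expr0 -[leRHS](Ex_cst P) le_eqVlt; apply/orP; left.
  have -> : Ex P (fun t => (F K j.+1 t)%:R) =
     Ex P (fun t => (F K j t)%:R * (~~ E (K + j)%N t)%:R).
    by apply: eq_Ex => t; rewrite FS; case: (F K j t); rewrite ?mul1r ?mul0r.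
  rewrite (ExM_indep_ge0 P w hiid _ _ _ _ _ (bmf_ind w _ _ (mF K j))
    (bmf_ind w _ _ (mb_neg w _ _ (mE (K + j)%N))))//; last first.
    apply/seteqP; split => // x []; rewrite /sites /=.
    by have := nk_mono K j; have := nk_le (K + j)%N; lia.
  rewrite exprSr; apply: ler_pM; rewrite ?Ex_ge0//.
  have -> : Ex P (fun t => (~~ E (K + j)%N t)%:R) = 1 - Ex P (fun t => (E (K + j)%N t)%:R).
    rewrite -[X in _ = X - _](Ex_cst P) -(ExB P w hiid _ _ _ (bmf_cst w _ 1) (bmf_ind w _ _ (mE (K + j)%N))).
    by apply: eq_Ex => t; case: (E _ _); rewrite ?subrr ?subr0.
  by rewrite lerB.
pose N K := \bigcap_j [set t | F K j t].
have mN K : measurable (N K).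
  by apply: bigcapT_measurable => j; apply: measurable_mb (mF K j).
have N0 K : P (N K) = 0%E.
  apply: null_of_small => e e0.
  have p01 : 0 <= 1 - p < 1 by lra.
  have [j hj] := expr_small R _ _ p01 e0.
  apply: (@le_trans _ _ (P [set t | F K j t])).
    apply: le_measure; rewrite ?inE//; last exact: bigcap_inf.
    exact: measurable_mb (mF K j).
  by rewrite -(Ex_prob P w hiid _ _ (mF K j)) lee_fin (le_trans (hF K j)).
have neg : P.-negligible (\bigcup_K N K).
  by apply: negligible_bigcup => K; apply/negligibleP; [exact: mN|exact: N0].
apply: negligibleS neg => t /= /existsNP[K hK]; exists K => // j _ /=.
apply/allP => i _; apply/negP => Ei; apply: hK; exists (K + i)%N => //; exact: leq_addr.
Qed.

(** By Markov's inequality and continuity along increasing M, the supremum of the partial sums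
    exceeds A with probability at most c/A, for every positive A. *)
Lemma ae_bounded_sums (Z : nat -> T -> R) (c : R) :
  (forall k, bmf w setT (Z k)) -> (forall k t, 0 <= Z k t) -> 0 < c ->
  (forall M, Ex P (fun t => \sum_(k < M) Z k t) <= c) ->
  {ae P, forall t, exists A : nat, forall M, \sum_(k < M) Z k t <= A%:R}.
Proof.
move=> mZ Z0 c0 hc.
pose B (A : nat) := \bigcup_M [set t | A%:R < \sum_(k < M) Z k t].
have mS M : bmf w setT (fun t => \sum_(k < M) Z k t) by exact: bmf_sum.
have mlt (A M : nat) : mb w setT (fun t => A%:R < \sum_(k < M) Z k t).
  by apply: mb_lt => //; exact: bmf_cst.
have mB1 (A M : nat) : measurable [set t | A%:R < \sum_(k < M) Z k t].
  exact: measurable_mb (mlt A M).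
have mB A : measurable (B A) by apply: bigcupT_measurable => M; exact: mB1.
have hB (A : nat) : (0 < A)%N -> (P (B A) <= (A%:R^-1 * c)%:E)%E.
  move=> A0.
  have nd : nondecreasing_seq (fun M => [set t | A%:R < \sum_(k < M) Z k t]).
    move=> M1 M2 M12; apply/subsetPset => t /= h; apply: (lt_le_trans h).
    rewrite -(subnKC M12) big_split_ord /= lerDl; exact: sumr_ge0.
  have cv := nondecreasing_cvg_mu (mB1 A) (mB A) nd (mu := P).
  rewrite -(cvg_lim _ cv)//; apply: lime_le; first by apply/cvg_ex; exists (P (B A)).
  near=> M; rewrite /= -[X in (X <= _)%E](Ex_prob P w hiid _ _ (mlt A M)) lee_fin.
  have A0' : 0 < A%:R :> R by rewrite ltr0n.
  apply: (@le_trans _ _ (A%:R^-1 * Ex P (fun t => \sum_(k < M) Z k t))).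
    rewrite -(ExZ P w hiid setT)//; apply: (Ex_le P w hiid setT).
    - exact: bmf_ind.
    - by apply: bmfM => //; exact: bmf_cst.
    - move=> t; case: ltP => [lt|_] /=.
        by rewrite mulrC ler_pdivlMr// mul1r ltW.
      by rewrite mulr_ge0 ?invr_ge0// sumr_ge0.
  by rewrite ler_wpM2l ?invr_ge0.
have neg : P.-negligible (\bigcap_A B A).
  apply/negligibleP; first exact: bigcapT_measurable.
  apply: null_of_small => e e0.
  have [A hA] : exists A : nat, (0 < A)%N /\ A%:R^-1 * c <= e.
    exists (Num.bound (c / e)).+1; split => //.
    rewrite mulrC ler_pdivrMr ?ltr0n// mulrC -ler_pdivrMr//.
    apply: ltW; apply: (@lt_trans _ _ (Num.bound (c / e))%:R).
      by apply: archi_boundP; rewrite divr_ge0// ltW.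
    by rewrite ltr_nat.
  case: hA => A0 hA; apply: (@le_trans _ _ (P (B A))).
    apply: le_measure; rewrite ?inE//; first exact: bigcapT_measurable.
    exact: bigcap_inf.
  by apply: (le_trans (hB A A0)); rewrite lee_fin.
apply: negligibleS neg => t /= hn A _.
apply: contrapT => hA; apply: hn; exists A => M.
by rewrite leNgt; apply/negP => lt; apply: hA; exists M.
Unshelve. all: by end_near. Qed.

End almost_sure.

(** * From valleys to return probabilities *)

Lemma sum_triangle (V : nmodType) (F : nat -> nat -> V) l :
  \sum_(m < l) \sum_(j < m.+1) F j (m - j)%N = \sum_(j < l) \sum_(i < l - j) F j i.
Proof.
elim: l => [|l IH]; first by rewrite !big_ord0.
rewrite big_ord_recr /= IH big_ord_recr /= [RHS]big_ord_recr /= subSnn big_ord1 subnn addrA.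
congr (_ + _); rewrite -big_split /=; apply: eq_bigr => j _.
by rewrite subSn ?big_ord_recr//= ltnW.
Qed.

Lemma site_index (n tm l nt : nat) (y : int) :
  (absz y <= n)%N -> (2 %| nt%:Z - (n%:Z + l%:Z - y))%Z -> exists a : nat,
  [/\ y = - (n%:Z + tm%:Z) + a%:Z,
      n%:Z + l%:Z = - (n%:Z + tm%:Z) + (n + n + tm + l)%N%:Z,
      (tm <= a <= n + n + tm)%N &
      (2 %| nt%:Z - ((n + n + tm + l)%N%:Z - a%:Z))%Z].
Proof. by move=> yn par; exists (absz (y + n%:Z + tm%:Z)%R); split; lia. Qed.

Lemma time_range (tm nt : nat) : (4 <= tm)%N -> (tm.-1 <= nt <= tm)%N ->
  (0 < nt <= tm)%N /\ (tm <= nt.+1)%N.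
Proof. by lia. Qed.

Section potential.
Context {R : realType} (om : int -> R).
Hypothesis om01 : forall z, 0 < om z < 1.

Definition rho (z : int) : R := (1 - om z) / om z.

Lemma rho_gt0 z : 0 < rho z.
Proof. by have := om01 z => ?; rewrite divr_gt0//; lra. Qed.

(** e^V normalised at 0. [Negz n] is the integer -(n+1), so the inverse product runs over the sites
    -n to 0. *)
Definition pot (z : int) : R :=
  match z with
  | Posz n => \prod_(i < n) rho (i.+1)%:Z
  | Negz n => (\prod_(i < n.+1) rho (- i%:Z))^-1
  end.

Lemma pot_gt0 z : 0 < pot z.
Proof.
by case: z => n; rewrite /pot ?invr_gt0; apply: prodr_gt0 => i _; exact: rho_gt0.
Qed.

Lemma pot0 : pot 0 = 1.
Proof. by change (pot (Posz 0) = 1); rewrite /pot big_ord0. Qed.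

Lemma potS z : pot (z + 1) = pot z * rho (z + 1).
Proof.
case: z => n.
  have -> : Posz n + 1 = n.+1%:Z by lia.
  by rewrite /pot big_ord_recr.
case: n => [|n].
  have -> : Negz 0 + 1 = 0 by lia.
  by rewrite pot0 /pot big_ord1 mulVf// lt0r_neq0// rho_gt0.
have -> : Negz n.+1 + 1 = Negz n by lia.
rewrite /pot [in RHS]big_ord_recr /= invfM -mulrA [X in _ * X]mulVf ?mulr1//.
by rewrite lt0r_neq0// rho_gt0.
Qed.

Lemma pot_balance z : om z * pot z = (1 - om z) * pot (z - 1).
Proof.
have := potS (z - 1); rewrite subrK => ->; rewrite /rho.
by have := om01 z => ?; field; rewrite lt0r_neq0//; lra.
Qed.

Definition pot_ratio (b : int) (i : nat) : R := \prod_(k < i) rho (b + k.+1%:Z).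
Local Notation XX := pot_ratio.

Lemma pot_ratio_gt0 b i : 0 < XX b i.
Proof. by apply: prodr_gt0 => k _; exact: rho_gt0. Qed.

Lemma potD b i : pot (b + i%:Z) = pot b * XX b i.
Proof.
elim: i => [|i IH]; first by rewrite addr0 /XX big_ord0 mulr1.
have -> : b + i.+1%:Z = b + i%:Z + 1 by lia.
rewrite potS IH /XX big_ord_recr /= mulrA; congr (_ * rho _); lia.
Qed.

Lemma potNE (k : nat) : (pot (- k%:Z))^-1 = XX (- k%:Z) k.
Proof.
have := potD (- k%:Z) k; rewrite addNr pot0 => h.
by apply: (mulfI (lt0r_neq0 (pot_gt0 (- k%:Z)))); rewrite -h mulfV// lt0r_neq0// pot_gt0.
Qed.

Variable bet : R.
Hypothesis bet1 : 1 <= bet.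
Hypothesis rho_le : forall z, rho z <= bet.
Hypothesis rhoV_le : forall z, (rho z)^-1 <= bet.

Lemma pot_ratio_le b i : XX b i <= bet ^+ i.
Proof.
have -> : bet ^+ i = \prod_(k < i) bet by rewrite prodr_const card_ord.
by apply: ler_prod => k _; rewrite rho_le ltW// rho_gt0.
Qed.

Lemma pot_ratioV_le b i : (XX b i)^-1 <= bet ^+ i.
Proof.
rewrite -prodfV; have -> : bet ^+ i = \prod_(k < i) bet by rewrite prodr_const card_ord.
by apply: ler_prod => k _; rewrite rhoV_le invr_ge0 ltW// rho_gt0.
Qed.

Lemma pot_pos (m : nat) : pot m%:Z = XX 0 m.
Proof. by have := potD 0 m; rewrite add0r => ->; rewrite pot0 mul1r. Qed.

Lemma pot_le z n : (absz z <= n)%N -> pot z <= bet ^+ n.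
Proof.
move=> zn; apply: (@le_trans _ _ (bet ^+ absz z)); last exact: ler_weXn2l.
case: z zn => m _; first by rewrite pot_pos; exact: pot_ratio_le.
have -> : Negz m = - m.+1%:Z by lia.
by rewrite abszN -[pot _]invrK potNE pot_ratioV_le.
Qed.

(** * Quenched estimates in one good block *)

Variables (eps Cq : R) (n tm l r : nat).
Hypothesis eps0 : 0 < eps.
Hypothesis om_ge : forall z, eps <= om z.
Hypothesis Cq0 : 0 <= Cq.
Hypothesis past_le : forall M, \sum_(k < M) XX (- k%:Z) k <= n%:R.

(* By ellipticity, bounds the contribution of the sites to the left of [n], as soon as the sum
   in [past_le] is at most [n]. *)
Definition past_bound : R := bet ^+ n * (n%:R + n%:R * bet ^+ n).
Local Notation Q := past_bound.

(** The leftmost site within reach in [tm] steps from [-n, n]. Sites are indexed from it, so [N0] is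
    the index of site [n], and [S] adds up e^(-V) from the left. *)
Let ll : int := - (n%:Z + tm%:Z).
Let e (k : nat) : R := pot (ll + k%:Z).
Let N0 : nat := (n + n + tm)%N.
Let S (m : nat) : R := \sum_(k < m) (e k)^-1.

Let e_gt0 k : 0 < e k. Proof. exact: pot_gt0. Qed.

Let e_site k : e (N0 + k) = pot (n%:Z + k%:Z).
Proof. by rewrite /e; congr pot; rewrite /ll /N0; lia. Qed.

Let e_ratio j i : e (N0 + (j + i)) = e (N0 + j) * XX (n%:Z + j%:Z) i.
Proof. by rewrite !e_site -potD; congr pot; lia. Qed.

(** Sites up to 0 are covered by [past_le] read backwards, sites 1 to n by ellipticity; the term of
    site n is added only to complete the range. *)
Lemma past_sum_le : S N0 <= n%:R + n%:R * bet ^+ n.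
Proof.
apply: (@le_trans _ _ (S ((n + tm).+1 + n))).
  have -> : ((n + tm).+1 + n = N0.+1)%N by rewrite /N0; lia.
  by rewrite /S big_ord_recr /= lerDl invr_ge0 ltW.
rewrite /S big_split_ord /=; apply: lerD.
  apply: le_trans (past_le (n + tm).+1).
  rewrite (reindex_inj rev_ord_inj) /=; apply: ler_sum => k _.
  rewrite -potNE /e le_eqVlt; apply/orP; left; apply/eqP; congr (pot _)^-1.
  by rewrite /ll; have := ltn_ord k; lia.
rewrite mulr_natl -[n in X in _ <= X]card_ord -sumr_const card_ord; apply: ler_sum => i _.
have -> : (e ((n + tm).+1 + i))^-1 = (XX 0 i.+1)^-1.
  by rewrite -pot_pos /e; congr (pot _)^-1; rewrite /ll; lia.
by apply: (le_trans (pot_ratioV_le 0 i.+1)); apply: ler_weXn2l.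
Qed.

Let S_ge0 m : 0 <= S m.
Proof. by apply: sumr_ge0 => k _; rewrite invr_ge0 ltW. Qed.

Let eN0 : e N0 * S N0 <= Q.
Proof.
apply: ler_pM => //; [by rewrite ltW| |exact: past_sum_le].
have := e_site 0; rewrite addn0 addr0 => ->; apply: pot_le; by [].
Qed.

Let S_le m : (m <= N0)%N -> S m <= S N0.
Proof.
move=> mN; rewrite /S -(subnKC mN) big_split_ord /= lerDl.
by apply: sumr_ge0 => k _; rewrite invr_ge0 ltW.
Qed.

Let S_site m : S (N0 + m) = S N0 + \sum_(j < m) (e (N0 + j))^-1.
Proof. by rewrite /S big_split_ord. Qed.

(** Up to 1/eps, the passage across one site costs [e z * S z.+1]. At most 2n of them occur before
    site [n], each costing at most [Q]. Beyond it, the part of [S] inherited from the past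
    contributes at most Q Cq, and the part created in the block is exactly the mass. *)
Lemma hit_time_le a : (tm <= a <= N0)%N -> \sum_(i < l) XX n%:Z i <= Cq ->
  hit_time om pot ll (N0 + l) a <=
  eps^-1 * ((n + n)%:R * Q + Q * Cq + \sum_(j < l) \sum_(i < l - j) XX (n%:Z + j%:Z) i).
Proof.
move=> /andP[ta aN] hR.
pose D z := e z * S z.+1.
apply: (@le_trans _ _ (\sum_(a <= z < N0 + l) eps^-1 * D z)).
  apply: ler_sum => z _; rewrite /D /S !mulr_sumr; apply: ler_sum => k _.
  rewrite -/(e z) -/(e k) invfM mulrA mulrA ler_wpM2r ?invr_ge0 ?(ltW (e_gt0 _))//.
  rewrite mulrC ler_wpM2r ?(ltW (e_gt0 _))// lef_pV2 ?posrE//.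
  by have := om01 (ll + k%:Z) => /andP[].
rewrite -mulr_sumr ler_wpM2l ?invr_ge0 ?(ltW eps0)//.
rewrite (big_cat_nat aN) ?leq_addr//= -addrA; apply: lerD.
  apply: (@le_trans _ _ (\sum_(a <= z < N0) Q)).
    apply: ler_sum_nat => z /andP[az zN]; apply: ler_pM => //.
    - by rewrite ltW.
    - by apply: pot_le; move: az zN ta; rewrite /ll /N0; lia.
    - by apply: (le_trans (S_le _ zN)); exact: past_sum_le.
  rewrite sumr_const_nat -[leLHS]mulr_natl; apply: ler_wpM2r.
    have b0 : 0 <= bet by apply: le_trans bet1.
    by rewrite mulr_ge0 ?exprn_ge0// addr_ge0// mulr_ge0 ?exprn_ge0.
  by rewrite ler_nat; move: ta; rewrite /N0; lia.
rewrite -{1}[N0]add0n big_addn addKn big_mkord.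
have DE (m : 'I_l) : D (m + N0)%N =
    XX n%:Z m * (e N0 * S N0) + \sum_(j < m.+1) XX (n%:Z + j%:Z) (m - j).
  rewrite addnC /D -addnS S_site mulrDr; congr (_ + _).
    have := e_ratio 0 m; rewrite addn0 add0n addr0 => ->; ring.
  rewrite mulr_sumr; apply: eq_bigr => j _.
  have jm : (j <= m)%N by rewrite -ltnS.
  have := e_ratio j (m - j); rewrite subnKC// => ->.
  by rewrite mulrAC mulfV ?mul1r// lt0r_neq0.
rewrite (eq_bigr _ (fun m _ => DE m)).
rewrite big_split /= (sum_triangle R (fun j i => XX (n%:Z + j%:Z) i)) lerD2r -mulr_suml mulrC.
have s0 : 0 <= \sum_(i < l) XX n%:Z i by apply: sumr_ge0 => i _; rewrite ltW// pot_ratio_gt0.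
by apply: ler_pM => //; rewrite mulr_ge0// ltW.
Qed.

(** The terms 1, Cq, Cq bound the relative masses of the past, of the slope down to the bottom and
    of the slope up to the barrier; replacing ratios of [om] by ellipticity costs 1/eps. *)
Lemma valley_mass_le :
  XX n%:Z l * Q <= 1 -> \sum_(j < l) XX (n%:Z + j%:Z) (l - j) <= Cq ->
  \sum_(i < r.+1) (XX (n%:Z + l%:Z) i)^-1 <= Cq ->
  \sum_(k < (N0 + l + r).+1) (om (ll + (N0 + l)%N%:Z) * pot (ll + (N0 + l)%N%:Z)) /
     (om (ll + k%:Z) * pot (ll + k%:Z)) <= eps^-1 * (1 + Cq + Cq).
Proof.
move=> hs hG hsh.
apply: (@le_trans _ _ (\sum_(k < (N0 + l + r).+1) eps^-1 * (e (N0 + l) * (e k)^-1))).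
  apply: ler_sum => k _; rewrite -/(e (N0 + l)) -/(e k) invfM mulrACA ler_wpM2r//.
    by apply: mulr_ge0; rewrite ?invr_ge0; apply: ltW.
  have /andP[p1 p2] := om01 (ll + (N0 + l)%N%:Z).
  have /andP[p3 p4] := om01 (ll + k%:Z).
  rewrite -[leRHS]mul1r; apply: ler_pM; [exact: ltW|by rewrite invr_ge0 ltW|exact: ltW|].
  by rewrite lef_pV2 ?posrE.
rewrite -mulr_sumr ler_wpM2l ?invr_ge0 ?(ltW eps0)// -mulr_sumr -/(S _) -addnS.
have -> : S (N0 + l + r.+1) = S N0 + \sum_(j < l) (e (N0 + j))^-1 +
    \sum_(i < r.+1) (e (N0 + l + i))^-1.
  by rewrite /S !big_split_ord.
rewrite !mulrDr; apply: lerD; first apply: lerD.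
- apply: le_trans hs; have := e_ratio 0 l; rewrite addn0 add0n addr0 => ->.
  by rewrite [e N0 * _]mulrC -mulrA ler_wpM2l// ltW// pot_ratio_gt0.
- apply: le_trans hG; rewrite mulr_sumr; apply: ler_sum => j _.
  have := e_ratio j (l - j); rewrite subnKC ?(ltnW (ltn_ord j))// => ->.
  by rewrite mulrAC mulfV ?mul1r// lt0r_neq0.
- apply: le_trans hsh; rewrite mulr_sumr; apply: ler_sum => i _.
  have := e_ratio l i; rewrite addnA => ->.
  by rewrite invfM mulrA mulfV ?mul1r// lt0r_neq0.
Qed.

Lemma trans_prob_ge_block y nt :
  (absz y <= n)%N -> (tm.-1 <= nt <= tm)%N -> (2 %| nt%:Z - (n%:Z + l%:Z - y))%Z ->
  \sum_(i < l) XX n%:Z i <= Cq ->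
  \sum_(j < l) \sum_(i < l - j) XX (n%:Z + j%:Z) i <= eps / 16 * (2 * tm%:R) ->
  XX n%:Z l * Q <= 1 -> \sum_(j < l) XX (n%:Z + j%:Z) (l - j) <= Cq ->
  \sum_(i < r.+1) (XX (n%:Z + l%:Z) i)^-1 <= Cq ->
  2 * tm%:R <= XX (n%:Z + l%:Z) r ->
  8 / eps * ((n + n)%:R * Q + Q * Cq) + 4 <= tm%:R ->
  (8 * (eps^-1 * (1 + Cq + Cq)))^-1 <= trans_prob om nt y (n%:Z + l%:Z).
Proof.
move=> yn ntm par hR hm hs hG hsh hbar htm.
have [a [ya bE taN par']] := site_index n tm l nt y yn par.
rewrite -/ll -/N0 in ya bE taN par'.
have b0 : 0 <= bet by apply: le_trans bet1.
have Q0 : 0 <= Q by rewrite mulr_ge0 ?exprn_ge0// addr_ge0// mulr_ge0 ?exprn_ge0.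
have A0 : 0 <= (n + n)%:R * Q + Q * Cq by rewrite addr_ge0// mulr_ge0.
have tm4 : 4 <= tm%:R :> R.
  apply: le_trans htm; rewrite lerDr; apply: mulr_ge0 => //.
  by rewrite divr_ge0// ltW.
have tm4' : (4 <= tm)%N by move: tm4; rewrite ler_nat.
have [nt0 nt_ge] := time_range tm nt tm4' ntm.
rewrite ya bE; apply: (trans_prob_ge_valley om pot om01 pot_gt0 pot_balance _ _ _ r _ tm).
- by case/andP: taN => -> aN /=; apply: leq_trans aN _; exact: leq_addr.
- exact: nt0.
- exact: par'.
- by rewrite mulr_gt0 ?invr_gt0// ltr_pwDl// ltr_pwDl.
- have -> : ll + (N0 + l)%N%:Z + r%:Z = n%:Z + l%:Z + r%:Z by rewrite bE.
  rewrite -bE (potD (n%:Z + l%:Z) r); have p0 := pot_gt0 (n%:Z + l%:Z); have x0 := pot_ratio_gt0 (n%:Z + l%:Z) r.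
  move: (pot _) (pot_ratio _ _) p0 x0 hbar => p x p0 x0 hbar.
  have -> : p / (p * x) = x^-1 by rewrite invfM mulrA mulfV ?mul1r// lt0r_neq0.
  rewrite ler_pdivrMr//.
  by rewrite mulrC ler_pdivlMr// mulrC.
- exact: valley_mass_le.
- apply: (@le_trans _ _ (2 * (eps^-1 * ((n + n)%:R * Q + Q * Cq + eps / 16 * (2 * tm%:R))))).
    apply: ler_wpM2l => //; apply: le_trans (hit_time_le a taN hR) _.
    by rewrite ler_wpM2l ?invr_ge0 ?(ltW eps0)// lerD2l.
  have nt1 : tm%:R - 1 <= nt%:R :> R.
    by rewrite lerBlDr natr1 ler_nat.
  apply: le_trans nt1.
  (* Twice the hitting time is at most (tm - 4)/4 from the past plus tm/4 from the mass, the 16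
     being chosen for the latter; the sum tm/2 - 1 is below tm - 1 <= nt. *)
  move: (_ + _ * Cq) A0 htm => A A0 htm.
  have -> : 2 * (eps^-1 * (A + eps / 16 * (2 * tm%:R))) = 4^-1 * (8 / eps * A) + tm%:R / 4.
    by field; rewrite lt0r_neq0.
  by move: tm4 htm; move: (8 / eps * A) => W; lra.
Qed.
End potential.

(** * Choice of the parameters *)

(* Written with [`^ (-1)] because measurability of powers is available. *)
Definition odds {R : realType} (v : R) : R := (1 - v) * v `^ (-1).

Lemma oddsE {R : realType} (v : R) : 0 < v -> odds v = (1 - v) / v.
Proof. by move=> v0; rewrite /odds powR_inv1// ltW. Qed.

Lemma measurable_odds {R : realType} : measurable_fun setT (@odds R).
Proof.
apply: measurable_funM; last exact: measurable_powR.
by apply: measurable_funB => //; exact: measurable_cst.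
Qed.

(** Young's inequality for v^2 = v^((q-2)/(q-1)) v^(q/(q-1)) with exponents (q-1)/(q-2) and q-1. It
    will bound the second moment of y by its first and q-th moments. *)
Lemma square_le_mix {R : realType} (v q : R) : 0 < v -> 2 < q ->
  v * v <= (q - 2) / (q - 1) * v + (q - 1)^-1 * v `^ q.
Proof.
move=> v0 q2.
have q1 : 0 < q - 1 by lra.
have q20 : 0 < q - 2 by lra.
pose a := (q - 2) / (q - 1).
have a0 : 0 < a by rewrite divr_gt0.
have := @conjugate_powR R (v `^ a) (v `^ (q / (q - 1))) a^-1 (q - 1).
rewrite -!powRrM mulfV ?lt0r_neq0// divfK ?lt0r_neq0// powRr1 ?(ltW v0)// invrK.
rewrite -powRD; last by apply/implyP => _; rewrite lt0r_neq0.
have -> : a + q / (q - 1) = 2%:R by rewrite /a; field; rewrite lt0r_neq0.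
rewrite powR_mulrn ?(ltW v0)// expr2 [v * a]mulrC [v `^ q / _]mulrC; apply.
- exact: powR_ge0.
- exact: powR_ge0.
- by rewrite invr_gt0.
- by [].
- by rewrite /a; field; rewrite lt0r_neq0.
Qed.

(** Each term is at most C, so a^q <= a C^(q-1). This passes from sums of [yprod] to sums of
    [xprod]. *)
Lemma sum_powR_le {R : realType} (I : finType) (a : I -> R) (C q : R) : 1 <= q ->
  (forall i, 0 < a i) -> \sum_i a i <= C -> \sum_i a i `^ q <= C `^ q.
Proof.
move=> q1 a0 aC.
have C0 : 0 <= C by apply: le_trans aC; apply: sumr_ge0 => i _; rewrite ltW.
have aiC i : a i <= C.
  by apply: le_trans aC; rewrite (bigD1 i)//= lerDl; apply: sumr_ge0 => j _; rewrite ltW.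
have split v : 0 < v -> v `^ q = v * v `^ (q - 1).
  move=> v0; have := @powRD R v 1 (q - 1); rewrite [1 + _]addrC subrK.
  by rewrite (powRr1 (ltW v0)); apply; apply/implyP => _; rewrite lt0r_neq0.
apply: (@le_trans _ _ (\sum_i a i * C `^ (q - 1))).
  apply: ler_sum => i _; rewrite split// ler_wpM2l ?(ltW (a0 i))//.
  by apply: ge0_ler_powR; rewrite ?nnegrE ?subr_ge0// ltW.
rewrite -mulr_suml; have [C00|Cn0] := eqVneq C 0.
  rewrite C00 in aC *.
  by apply: le_trans (ler_wpM2r (powR_ge0 _ _) aC) _; rewrite mul0r powR_ge0.
rewrite (split C) ?lt0r ?Cn0//; apply: ler_wpM2r => //; exact: powR_ge0.
Qed.

Lemma parity_time (tm : nat) (b z : int) : (0 < tm)%N -> exists nt : nat,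
  (tm.-1 <= nt <= tm)%N /\ (2 %| nt%:Z - (b - z))%Z.
Proof.
move=> tm0; have [par|par] := boolP (2 %| tm%:Z - (b - z))%Z.
  by exists tm; split => //; lia.
by exists tm.-1; split => //; lia.
Qed.

Lemma parity_shift (nt : nat) (b z z' : int) : (2 %| nt%:Z - (b - z'))%Z ->
  (2 %| z - z')%Z -> (2 %| nt%:Z - (b - z))%Z.
Proof. by lia. Qed.

Section theorem.
Context {R : realType} {d0 : measure_display} {T : measurableType d0}.
Context (P : probability T R) (w : int -> T -> R).
Hypothesis hiid : iid_family P w.
Hypothesis hval : forall (x : int) (t : T), 0 < w x t < 1.
Variable eps0 : R.
Hypothesis heps0 : 0 < eps0 < 2^-1.
Hypothesis hell : P [set t | eps0 <= w 0 t <= 1 - eps0] = 1%E.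
Hypothesis hlog : (\int[P]_t (ln ((1 - w 0 t) / w 0 t))%:E < 0)%E.
Variable kappa : R.
Hypothesis hkappa : 0 < kappa < 1.
Hypothesis hmom : (\int[P]_t (((1 - w 0 t) / w 0 t) `^ kappa)%:E = 1)%E.

(* Changes the environment only on a null set. *)
Definition clamp (v : R) : R := if (eps0 <= v) && (v <= 1 - eps0) then v else 2^-1.

Lemma clamp_itv v : eps0 <= clamp v <= 1 - eps0.
Proof.
rewrite /clamp; case: ifP => // _; have := heps0 => ?; apply/andP; split; lra.
Qed.

Lemma clamp01 v : 0 < clamp v < 1.
Proof. by have := clamp_itv v; have := heps0 => ? ?; apply/andP; split; lra. Qed.

Lemma measurable_clamp : measurable_fun setT clamp.
Proof.
apply: measurable_fun_ifT => //; apply: measurable_and.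
  by apply: measurable_fun_ler => //; exact: measurable_cst.
by apply: measurable_fun_ler => //; exact: measurable_cst.
Qed.

Let th : R := kappa / 2.
Let q : R := th^-1.
Let b0 : R := (1 - eps0) / eps0.
Let be : R := b0 `^ th.

Let th_gt0 : 0 < th. Proof. by rewrite /th; have := hkappa; lra. Qed.

Let q_gt2 : 2 < q.
Proof.
rewrite /q -[2]invrK ltf_pV2 ?posrE ?invr_gt0//.
by rewrite /th; have := hkappa; lra.
Qed.

Let b0_gt1 : 1 < b0.
Proof. by rewrite /b0 ltr_pdivlMr; have := heps0; lra. Qed.

Let be_gt1 : 1 < be.
Proof.
have := @gt0_ltr_powR R th th_gt0 1 b0; rewrite powR1; apply => //.
  by rewrite nnegrE.
by rewrite nnegrE ltW// (lt_trans _ b0_gt1).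
Qed.

Definition hy (v : R) : R := odds (clamp v) `^ (kappa / 2).

Let y x t := hy (w x t).

Let odds_gt0 v : 0 < odds (clamp v).
Proof.
have /andP[c0 c1] := clamp01 v; rewrite oddsE// divr_gt0//; lra.
Qed.

Let odds_le v : odds (clamp v) <= b0.
Proof.
have /andP[c0 c1] := clamp_itv v; have /andP[c2 _] := clamp01 v; rewrite oddsE//.
have e0 : 0 < eps0 by case/andP: heps0.
apply: ler_pM; rewrite ?invr_ge0 ?(ltW c2)//; try lra.
by rewrite lef_pV2 ?posrE.
Qed.

Let oddsV_le v : (odds (clamp v))^-1 <= b0.
Proof.
have /andP[c0 c1] := clamp_itv v; have /andP[c2 c3] := clamp01 v; rewrite oddsE// invf_div.
have e0 : 0 < eps0 by case/andP: heps0.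
have c4 : 0 < 1 - clamp v by lra.
apply: ler_pM; rewrite ?invr_ge0 ?(ltW c2) ?(ltW c4)//.
by rewrite lef_pV2 ?posrE//; lra.
Qed.

Let hy_gt0 v : 0 < hy v. Proof. exact: powR_gt0. Qed.

Let hy_le v : hy v <= be.
Proof.
have b00 : 0 <= b0 by rewrite ltW// (lt_trans _ b0_gt1).
by apply: ge0_ler_powR => //; rewrite ?nnegrE// ltW.
Qed.

Let hyV_le v : (hy v)^-1 <= be.
Proof.
have b00 : 0 <= b0 by rewrite ltW// (lt_trans _ b0_gt1).
rewrite /hy -powRN.
have -> : odds (clamp v) `^ (- (kappa / 2)) = (odds (clamp v))^-1 `^ (kappa / 2).
  by rewrite -[in RHS]powR_inv1 ?(ltW (odds_gt0 _))// -powRrM mulN1r.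
by apply: ge0_ler_powR => //; rewrite ?nnegrE ?invr_ge0// ltW.
Qed.

Let hyq v : hy v `^ q = odds (clamp v).
Proof. by rewrite /hy /q -powRrM mulfV ?lt0r_neq0// powRr1// ltW. Qed.

Lemma measurable_odds_clamp : measurable_fun setT (odds \o clamp).
Proof. exact: measurableT_comp measurable_odds measurable_clamp. Qed.

Lemma measurable_hy : measurable_fun setT hy.
Proof. exact: measurableT_comp (measurable_powR _) measurable_odds_clamp. Qed.

Let bmf_y x : bmf w [set x] (y x).
Proof.
apply: (bmf_site w hy); first exact: measurable_hy.
by exists be => t; rewrite ger0_norm ?hy_le// ltW.
Qed.

Let bmf_yV x : bmf w [set x] (fun t => (y x t)^-1).
Proof.
apply: (bmf_site w (fun v => (hy v)^-1)); last first.
  by exists be => t; rewrite ger0_norm ?hyV_le// invr_ge0 ltW.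
rewrite (_ : (fun v => _) = (fun v => odds (clamp v) `^ (- (kappa / 2)))).
  exact: measurableT_comp (measurable_powR _) measurable_odds_clamp.
by apply/funext => v; rewrite powRN.
Qed.

Let bmf_yq x : bmf w [set x] (fun t => y x t `^ q).
Proof.
apply: (bmf_site w (fun v => hy v `^ q)); last first.
  by exists b0 => t; rewrite hyq ger0_norm ?odds_le// ltW.
exact: measurableT_comp (measurable_powR _) measurable_hy.
Qed.

(** * The moments of y *)

Let mu : R := Ex P (y 0).
Let nu : R := Ex P (fun t => y 0 t `^ q).

Let Ey x : Ex P (y x) = mu.
Proof.
apply: (Ex_site P w hiid hy); first exact: measurable_hy.
by move=> v; rewrite ltW.
Qed.

Let Eyq x : Ex P (fun t => y x t `^ q) = nu.
Proof.
apply: (Ex_site P w hiid (fun v => hy v `^ q)); last by move=> v; exact: powR_ge0.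
exact: measurableT_comp (measurable_powR _) measurable_hy.
Qed.

Let in_range x := [set t | eps0 <= w x t <= 1 - eps0].

Lemma ae_in_range : {ae P, forall t, forall x, clamp (w x t) = w x t}.
Proof.
have mB : measurable [set v : R | eps0 <= v <= 1 - eps0].
  have -> : [set v : R | eps0 <= v <= 1 - eps0] = `[eps0, 1 - eps0]%classic.
    by apply/seteqP; split => v; rewrite /= in_itv.
  exact: measurable_itv.
have mA x : measurable (in_range x).
  by have := measurable_site P w hiid x measurableT _ mB; rewrite setTI.
have PA x : P (in_range x) = 1%E.
  have [_ [_ h]] := hiid; rewrite -hell; exact: (h x _ mB).
have neg x : P.-negligible (~` in_range x).
  apply/negligibleP; first exact: measurableC.
  by rewrite [LHS](probability_setC P (mA x)) PA subee.
(* An enumeration of the integers, nonnegative ones at even indices and negative ones at odd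
   indices, for the countable union. *)
pose f (k : nat) : int := if odd k then Negz k./2 else Posz k./2.
have ng : P.-negligible (\bigcup_k ~` in_range (f k)) by exact: negligible_bigcup.
apply: negligibleS ng => t /= /existsNP[x hx].
exists (if x is Posz k then k.*2 else if x is Negz k then k.*2.+1 else 0%N) => //.
have -> : f (if x is Posz k then k.*2 else if x is Negz k then k.*2.+1 else 0%N) = x.
  by case: x {hx} => k; rewrite /f /= odd_double ?doubleK//= uphalf_double.
by move=> hr; apply: hx; rewrite /clamp ifT.
Qed.

Let mw0 : measurable_fun setT (w 0). Proof. exact: (measurable_site P w hiid). Qed.

Let Ey2 x : Ex P (fun t => y x t * y x t) = 1.
Proof.
have mh : measurable_fun setT (fun v => hy v * hy v).
  by apply: measurable_funM; exact: measurable_hy.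
rewrite (Ex_site P w hiid (fun v => hy v * hy v))//; last by move=> v; rewrite mulr_ge0// ltW.
rewrite /Ex /Rintegral -[RHS]/(fine 1%E) -hmom; congr fine.
apply: ae_eq_integral => //.
- apply/measurable_EFinP; exact: (measurableT_comp mh mw0).
- apply/measurable_EFinP; rewrite (_ : (fun t => _) = (fun t => odds (w 0 t) `^ kappa)).
    exact: (measurableT_comp (measurable_powR _) (measurableT_comp measurable_odds mw0)).
  by apply/funext => t; rewrite oddsE//; case/andP: (hval 0 t).
- apply: filterS ae_in_range => t /(_ 0) ht _; rewrite /hy ht; congr EFin.
  have w0 : 0 < w 0 t by case/andP: (hval 0 t).
  have o0 : 0 < odds (w 0 t) by rewrite -ht odds_gt0.
  rewrite -powRD -?oddsE// -?splitr//.
  by apply/implyP => _; rewrite lt0r_neq0.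
Qed.

Let mu_gt0 : 0 < mu.
Proof.
have bV : 0 < be^-1 by rewrite invr_gt0 (lt_trans _ be_gt1).
apply: (lt_le_trans bV); rewrite -(Ex_cst P be^-1).
apply: (Ex_le P w hiid _ _ _ (bmf_cst w _ _) (bmf_y 0)) => t.
have b0' : 0 < be by apply: lt_trans be_gt1.
have y0 : 0 < y 0 t by exact: hy_gt0.
by rewrite -[y 0 t]invrK lef_pV2 ?posrE ?invr_gt0//; exact: hyV_le.
Qed.

(** If mu >= 1, then E (y - 1)^2 = 2 - 2 mu <= 0, so y = 1 and log rho = 0 almost surely, against
    the negative mean of log rho. *)
Let mu_lt1 : mu < 1.
Proof.
rewrite ltNge; apply/negP => mu1.
pose f t := (y 0 t - 1) * (y 0 t - 1).
have mf : bmf w [set (0 : int)] f.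
  by apply: bmfM; apply: bmfB => //; exact: bmf_cst.
have f0 t : 0 <= f t by rewrite /f -expr2 sqr_ge0.
have Ef : Ex P f <= 0.
  have m1 := bmfM w _ _ _ (bmf_y 0) (bmf_y 0).
  have m2 := bmfM w _ _ _ (bmf_cst w [set (0 : int)] 2) (bmf_y 0).
  have m3 := bmfB w _ _ _ m1 m2.
  have -> : Ex P f = Ex P (fun t => y 0 t * y 0 t - 2 * y 0 t + 1).
    by apply: eq_Ex => t; rewrite /f; ring.
  rewrite (ExD P w hiid _ _ _ m3 (bmf_cst w _ 1)) (ExB P w hiid _ _ _ m1 m2).
  by rewrite (ExZ P w hiid _ _ _ (bmf_y 0)) Ex_cst Ey2 -/mu; lra.
have If : (\int[P]_t `|(f t)%:E| = 0)%E.
  transitivity (\int[P]_t (f t)%:E)%E.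
    by apply: eq_integral => t _; rewrite gee0_abs// lee_fin.
  rewrite -(EFin_Ex P w hiid _ _ mf); congr EFin; apply/eqP.
  by rewrite eq_le Ef Ex_ge0.
have mfT : measurable_fun setT f := bmf_measurable P w hiid _ _ mf.
have := ae_eq_integral_abs P measurableT (proj2 (measurable_EFinP _ _) mfT).
move=> /(proj1)/(_ If) aef.
have : (\int[P]_t (ln ((1 - w 0 t) / w 0 t))%:E = \int[P]_t 0)%E.
  apply: ae_eq_integral => //.
  - apply/measurable_EFinP; rewrite (_ : (fun t => _) = (fun t => ln (odds (w 0 t)))).
      exact: (measurableT_comp (@measurable_ln R) (measurableT_comp measurable_odds mw0)).
    by apply/funext => t; rewrite oddsE//; case/andP: (hval 0 t).
  - apply: filterS2 aef ae_in_range => t h /(_ 0) ht _.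
    have := h I => -[/eqP]; rewrite /f mulf_eq0 orbb subr_eq0 /y /hy ht powR_eq1 => h1.
    have w0 : 0 < w 0 t by case/andP: (hval 0 t).
    have o0 : 0 < odds (w 0 t) by rewrite -ht odds_gt0.
    rewrite -oddsE//; move: h1 => /or3P[/eqP ->|o1|/eqP k0]; first by rewrite ln1.
      by move: o0; rewrite ltNge (ltW o1).
    by move: th_gt0; rewrite /th k0 ltxx.
rewrite integral0 => h; by move: hlog; rewrite h ltxx.
Qed.

(** Taking means in [square_le_mix] gives q - 1 <= (q - 2) mu + nu, and mu < 1. *)
Let nu_gt1 : 1 < nu.
Proof.
have q1 : 0 < q - 1 by have := q_gt2; lra.
have m1 := bmfM w _ _ _ (bmf_y 0) (bmf_y 0).
have m2 := bmfM w _ _ _ (bmf_cst w [set (0 : int)] ((q - 2) / (q - 1))) (bmf_y 0).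
have m3 := bmfM w _ _ _ (bmf_cst w [set (0 : int)] (q - 1)^-1) (bmf_yq 0).
have := Ex_le P w hiid _ _ _ m1 (bmfD w _ _ _ m2 m3)
  (fun t => square_le_mix (y 0 t) q (hy_gt0 _) q_gt2).
rewrite (ExD P w hiid _ _ _ m2 m3) (ExZ P w hiid _ _ _ (bmf_y 0)) (ExZ P w hiid _ _ _ (bmf_yq 0)).
rewrite Ey2 -/mu -/nu => h.
have := mu_lt1 => m1'; have := q_gt2 => q2.
have h2 : (q - 1) * 1 <= (q - 1) * ((q - 2) / (q - 1) * mu + (q - 1)^-1 * nu).
  by rewrite ler_wpM2l// ltW.
have e : (q - 1) * ((q - 2) / (q - 1) * mu + (q - 1)^-1 * nu) = (q - 2) * mu + nu.
  by field; rewrite lt0r_neq0.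
rewrite e in h2; nra.
Qed.

Let mu01 : 0 < mu < 1. Proof. by rewrite mu_gt0 mu_lt1. Qed.

Let om (t : T) (z : int) : R := clamp (w z t).

Let om01 t z : 0 < om t z < 1. Proof. exact: clamp01. Qed.

Let rho_om t z : rho (om t) z = odds (clamp (w z t)).
Proof. by rewrite oddsE//; case/andP: (clamp01 (w z t)). Qed.

Let xprod_om b i t : xprod y q b i t = pot_ratio (om t) b i.
Proof.
elim: i => [|i IH]; first by rewrite xprod0 /pot_ratio big_ord0.
rewrite (xprodS y q (fun x t => hy_gt0 _)) IH /pot_ratio big_ord_recr /= rho_om.
by congr (_ * _); exact: hyq.
Qed.

Let Yp b i t : 0 < yprod y b i t. Proof. exact: (yprod_gt0 y (fun x t => hy_gt0 _)). Qed.

Let q_ge1 : 1 <= q. Proof. by have := q_gt2; lra. Qed.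

(** The k-th term is e^(-kappa V(-k) / 2), of mean mu^k. The bound depends on the environment and is
    later absorbed by starting from a large n. *)
Lemma ae_past_bounded : {ae P, forall t, exists A : nat, forall M,
  \sum_(k < M) yprod y (- k%:Z) k t <= A%:R}.
Proof.
apply: (ae_bounded_sums P w hiid (fun k => yprod y (- k%:Z) k) (1 - mu)^-1).
- move=> k; apply: (bmf_yprod w y be q mu nu be_gt1 q_gt2 bmf_y mu01 nu_gt1) => //.
- by move=> k t; rewrite ltW.
- by rewrite invr_gt0 subr_gt0; exact: mu_lt1.
- move=> M; rewrite (Ex_sum P w hiid setT); last first.
    by move=> k; apply: (bmf_yprod w y be q mu nu be_gt1 q_gt2 bmf_y mu01 nu_gt1).
  rewrite (eq_bigr (fun k : 'I_M => mu ^+ k)); first exact: geom_le mu01 M.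
  move=> k _; exact: (Ex_yprod P w hiid y be q mu nu be_gt1 (fun x t => hy_gt0 _) q_gt2 bmf_y
    mu01 nu_gt1 Ey).
Qed.

Let C0 : R := valley_bound mu.
Let Cq : R := C0 `^ q.
Let Q (n : nat) : R := past_bound b0 n.

Let Q_ge0 n : 0 <= Q n.
Proof.
have b00 : 0 <= b0 by rewrite ltW// (lt_trans _ b0_gt1).
by rewrite mulr_ge0 ?exprn_ge0// addr_ge0// mulr_ge0 ?exprn_ge0.
Qed.

Let eps_gt0 : 0 < eps0. Proof. by case/andP: heps0. Qed.

(** The outcome of [block_exists] for eta = eps0/16 and del = 1/(1 + Q n). The added 1 keeps [yprod]
    at most 1, so that its q-th power is no larger and still beats [Q n]. *)
Let deep (n tm : nat) (t : T) := exists l r : nat,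
  [/\ mass y q n%:Z l t <= eps0 / 16 * (2 * tm%:R), \sum_(i < l) yprod y n%:Z i t <= C0,
      yprod y n%:Z l t <= (1 + Q n)^-1, \sum_(j < l) yprod y (n%:Z + j%:Z) (l - j) t <= C0 &
      2 * tm%:R <= xprod y q (n%:Z + l%:Z) r t /\ shallow y C0 (n%:Z + l%:Z) r t].

(** A single [b] serves every start within distance n of 0 and both admissible times: the walkers
    need a common meeting place. *)
Lemma trans_prob_ge_deep n tm t (A : nat) : deep n tm t ->
  8 / eps0 * ((n + n)%:R * Q n + Q n * Cq) + 4 <= tm%:R ->
  (forall M, \sum_(k < M) yprod y (- k%:Z) k t <= A%:R) -> A%:R `^ q <= n%:R ->
  exists b : int, forall z nt, (absz z <= n)%N -> (tm.-1 <= nt <= tm)%N ->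
    (2 %| nt%:Z - (b - z))%Z ->
    (8 * (eps0^-1 * (1 + Cq + Cq)))^-1 <= trans_prob (om t) nt z b.
Proof.
move=> [l [r [hm hR hs hG [hbar hsh]]]] htm hA An; exists (n%:Z + l%:Z) => z nt zn ntm par.
have Xsum (I : finType) (b : I -> int) (i : I -> nat) (C : R) :
    \sum_k yprod y (b k) (i k) t <= C -> \sum_k pot_ratio (om t) (b k) (i k) <= C `^ q.
  move=> hC; apply: le_trans (sum_powR_le I (fun k => yprod y (b k) (i k) t) C q q_ge1 _ hC).
    by apply: ler_sum => k _; rewrite -xprod_om.
  by move=> k; exact: Yp.
have Q1 : 0 < 1 + Q n by rewrite ltr_pwDl// Q_ge0.
apply: (trans_prob_ge_block (om t) (om01 t) b0 (ltW b0_gt1) _ _ eps0 Cq n tm l r) => //.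
- by move=> x; rewrite rho_om.
- by move=> x; rewrite rho_om.
- by move=> x; case/andP: (clamp_itv (w x t)).
- exact: powR_ge0.
- by move=> M; apply: le_trans An; exact: (Xsum _ (fun k : 'I_M => - (k : nat)%:Z) (fun k : 'I_M => k : nat)).
- exact: (Xsum _ (fun i : 'I_l => n%:Z) (fun i : 'I_l => i : nat)).
- apply: le_trans hm; apply: ler_sum => j _; apply: ler_sum => i _.
  by rewrite xprod_om.
- have Y1 : yprod y n%:Z l t <= 1.
    by apply: (le_trans hs); rewrite invf_le1// lerDl Q_ge0.
  rewrite -xprod_om; apply: (@le_trans _ _ ((1 + Q n)^-1 * Q n)).
    apply: ler_wpM2r; first exact: Q_ge0.
    apply: le_trans hs; apply: ge1r_powR => //.
    by rewrite Yp Y1.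
  by rewrite mulrC ler_pdivrMr// mul1r lerDr.
- exact: (Xsum _ (fun j : 'I_l => n%:Z + (j : nat)%:Z) (fun j : 'I_l => (l - j)%N)).
- apply: le_trans (sum_powR_le 'I_r.+1 (fun i => (yprod y (n%:Z + l%:Z) i t)^-1) C0 q q_ge1 _ hsh).
    apply: ler_sum => i _; rewrite -xprod_om /xprod -powR_inv1 ?powR_ge0//.
    by rewrite -powR_inv1 ?(ltW (Yp _ _ _))// powRAC.
  by move=> i; rewrite invr_gt0.
- by rewrite -xprod_om.
Qed.

Lemma ae_quenched_io (d : nat) (hd : (2 <= d)%N) (x : 'I_d -> int) : samepar d x ->
  {ae P, forall t, quenched_io (fun z => w z t) x = 1%E}.
Proof.
move=> hpar.
have eta0 : 0 < eps0 / 16 by rewrite divr_gt0.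
have [p p0 blk] := block_exists P w hiid y be q mu nu be_gt1 (fun x t => hy_gt0 _)
  (fun x t => hy_le _) q_gt2 bmf_y bmf_yV bmf_yq mu01 nu_gt1 Ey Ey2 Eyq _ eta0.
pose Hm (n : nat) : R := 8 / eps0 * ((n + n)%:R * Q n + Q n * Cq) + 4.
have del0 n : 0 < (1 + Q n)^-1 by rewrite invr_gt0 ltr_pwDl.
have /choice[f Hf] : forall n : nat, exists F : nat * nat * (T -> bool),
  [/\ (0 < F.1.1)%N, mb w (sites n%:Z F.1.1) F.2, p <= Ex P (fun t => (F.2 t)%:R),
    Hm n <= F.1.2%:R & forall t, F.2 t -> deep n F.1.2 t].
  move=> n; have [len [tm [E [h1 h2 h3 h4 h5]]]] := blk n%:Z _ (Hm n) (del0 n).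
  by exists (len, tm, E).
(* The parameters and the length of a block depend on where it starts, hence the recursion; each
   block begins where the previous one ends. *)
pose nk := fix nk k := if k is k'.+1 then (nk k' + (f (nk k')).1.1)%N else 0%N.
have nkS k : nk k.+1 = (nk k + (f (nk k)).1.1)%N by [].
have nk_ge k : (k <= nk k)%N.
  elim: k => [//|k IH]; rewrite nkS -addn1 leq_add//.
  by case: (Hf (nk k)).
have io := ae_infinitely_often P w hiid nk (fun k => (f (nk k)).2) p p0.
have {io} io : {ae P, forall t, forall K, exists2 k, (K <= k)%N & (f (nk k)).2 t}.
  apply: io => k; first by rewrite nkS leq_addr.
    by rewrite nkS addKn; case: (Hf (nk k)).
  by case: (Hf (nk k)).
apply: filterS3 io ae_past_bounded ae_in_range => t io [A hA] hw.
have omE : (fun z => w z t) = om t by apply/funext => z; rewrite /om hw.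
rewrite omE.
pose c1 : R := (8 * (eps0^-1 * (1 + Cq + Cq)))^-1.
have Cq0 : 0 <= Cq by exact: powR_ge0.
have c10 : 0 < c1.
  by rewrite invr_gt0 mulr_gt0// mulr_gt0 ?invr_gt0// -addrA ltr_pwDl// addr_ge0.
apply: (quenched_io_eq1 (om t) d (om01 t) (c1 ^+ d)) => //; first exact: exprn_gt0.
move=> z hz.
(* The start of the block has to dominate both the bound on the past and the positions of the
   walkers; blocks of index at least [K] do, since k <= nk k. *)
pose K := maxn (Num.bound (A%:R `^ q : R)) (\max_(j < d) absz (z j)).
have [k Kk Ek] := io K.
set n := nk k in Ek.
have Kn : (K <= n)%N by apply: leq_trans Kk (nk_ge k).
have [_ _ _ hH hdeep] := Hf n.
have An : A%:R `^ q <= n%:R :> R.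
  apply: ltW; apply: (lt_le_trans (archi_boundP (powR_ge0 _ _))).
  by rewrite ler_nat; apply: leq_trans Kn; exact: leq_maxl.
have zn j : (absz (z j) <= n)%N.
  apply: leq_trans Kn; apply: leq_trans (leq_maxr _ _).
  exact: (leq_bigmax_cond (F := fun j => absz (z j))).
have [b hb] := trans_prob_ge_deep n _ t A (hdeep t Ek) hH hA An.
set tm := (f n).1.2 in hb.
pose i0 := Ordinal (leq_trans (ltn0Sn 1) hd).
(* One of tm - 1 and tm has the parity required by one walker, hence by all of them. *)
have [nt [ntm par]] : exists nt : nat, (tm.-1 <= nt <= tm)%N /\
    (2 %| nt%:Z - (b - z i0))%Z.
  apply: parity_time; rewrite -(ltr_nat R); apply: lt_le_trans hH.
  rewrite /Hm ltr_wpDl// mulr_ge0// ?divr_ge0// ?(ltW eps_gt0)//.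
  by rewrite addr_ge0// mulr_ge0.
exists nt; apply: le_trans (coinc_prob_ge_prod (om t) d (om01 t) nt z b).
have -> : c1 ^+ d = \prod_(j < d) c1 by rewrite prodr_const card_ord.
apply: ler_prod => j _; rewrite (ltW c10) /=; apply: hb => //.
exact: parity_shift par (hz j i0).
Qed.

End theorem.

(** Almost sure equality is transferred to integrals of measurable functions. Each [coinc_prob] is a
    polynomial in finitely many [w z], and the infimum and supremum are countable. *)
Lemma measurable_quenched_io {R : realType} {d0 : measure_display} {T : measurableType d0}
  (w : int -> T -> R) (d : nat) (x : 'I_d -> int) :
  (forall z, measurable_fun setT (w z)) ->
  measurable_fun setT (fun t => quenched_io (fun z => w z t) x).
Proof.
move=> mw.
have mc N M : measurable_fun setT (fun t => (coinc_prob (fun z => w z t) x N M)%:E).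
  apply/measurable_EFinP.
  rewrite (_ : (fun t => _) = fun t => \sum_(B : {ffun 'I_d -> {ffun 'I_M -> bool}})
     [exists n : 'I_M.+1, (N <= n)%N && coincide x B n]%:R *
     \prod_(j < d) path_prob (fun z => w z t) (x j) (B j)); last first.
    by apply/funext => t; rewrite coinc_probE.
  apply: measurable_sum => B; apply: measurable_funM; first exact: measurable_cst.
  apply: measurable_prod => j _; apply: measurable_prod => k _.
  case: (B j k); first exact: mw.
  by apply: measurable_funB => //; exact: measurable_cst.
rewrite (_ : (fun t => _) = fun t => einfs (fun N => esups (fun M =>
    (coinc_prob (fun z => w z t) x N M)%:E) 0%N) 0%N); last first.
  apply/funext => t; rewrite /quenched_io /einfs /sdrop /=; congr ereal_inf.
  by apply/seteqP; split => _ [N _ <-]; exists N => //; rewrite /esups /sdrop /=;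
    congr ereal_sup; apply/seteqP; split => _ [M _ <-]; exists M.
apply: (measurable_fun_einfs (f := fun N t => esups (fun M =>
    (coinc_prob (fun z => w z t) x N M)%:E) 0%N)) => N.
exact: (measurable_fun_esups (f := fun M t => (coinc_prob (fun z => w z t) x N M)%:E)).
Qed.

Theorem theorem1p1 (R : realType) (d0 : measure_display) (T : measurableType d0)
  (P : probability T R) (w : int -> T -> R)
  (hiid : iid_family P w)
  (hval : forall (x : int) (t : T), 0 < w x t < 1)
  (eps0 : R) (heps0 : 0 < eps0 < 2^-1)
  (hell : P [set t | eps0 <= w 0 t <= 1 - eps0] = 1%E)
  (hlog : (\int[P]_t (ln ((1 - w 0 t) / w 0 t))%:E < 0)%E)
  (kappa : R) (hkappa : 0 < kappa < 1)
  (hmom : (\int[P]_t (((1 - w 0 t) / w 0 t) `^ kappa)%:E = 1)%E)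
  (d : nat) (hd : (2 <= d)%N) (x : 'I_d -> int)
  (hpar : forall i j : 'I_d, (2 %| x i - x j)%Z) :
  (\int[P]_t quenched_io (fun y => w y t) x = 1)%E.
Proof.
transitivity (\int[P]_t (cst 1%E t : \bar R))%E; last first.
  by rewrite integral_cst// mul1e; exact: probability_setT.
apply: ae_eq_integral => //.
  by apply: measurable_quenched_io; case: hiid.
apply: filterS (ae_quenched_io P w hiid hval eps0 heps0 hell hlog kappa hkappa hmom d hd x hpar).
by move=> t ->.
Qed.
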